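(* Let $n\ge 2$ be an integer and let $t>0$ with $t\notin\Big[\frac{n}{n+\sqrt n},\frac{n}{n-\sqrt n}\Big]$. Then there is a $*$-isomorphism of von Neumann algebras $$\Gamma_{t,n}\cong\mathbb B(\ell_2)\oplus\Gamma_{1,n}.$$ Moreover the vacuum state $\phi$ is not faithful on $\Gamma_{t,n}$.
   Context: Let $t>0$, let $\mathcal H_{\mathbb R}$ be a real Hilbert space of dimension $n<\infty$ and $\mathcal H$ its complexification (inner product linear in the first variable). The $t$-deformed Fock space is the Hilbert space direct sum $\mathcal F_t=\mathbb C\Omega\oplus\bigoplus_{k\ge 1}t^{k-1}\mathcal H^{\otimes k}$, where $\Omega$ is a unit vector and $t^{k-1}\mathcal H^{\otimes k}$ means the space $\mathcal H^{\otimes k}$ with its usual inner product multiplied by $t^{k-1}$. For $e\in\mathcal H_{\mathbb R}$, the creation operator $l_t(e)$ is the bounded operator on $\mathcal F_t$ with $l_t(e)\Omega=e$ and $l_t(e)(h_1\otimes\cdots\otimes h_k)=e\otimes h_1\otimes\cdots\otimes h_k$; its adjoint satisfies $l_t(e)^*\Omega=0$, $l_t(e)^*h=\langle h,e\rangle\Omega$, and $l_t(e)^*(h_1\otimes\cdots\otimes h_k)=t\langle h_1,e\rangle h_2\otimes\cdots\otimes h_k$ for $k\ge 2$. Put $s^t(e)=l_t(e)+l_t(e)^*$. The $t$-gaussian von Neumann algebra is $\Gamma_{t,n}=\{s^t(e): e\in\mathcal H_{\mathbb R}\}''\subset\mathbb B(\mathcal F_t)$. The vacuum state is $\phi(x)=\langle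 x\Omega,\Omega\rangle$. $\mathbb B(\ell_2)$ is the algebra of bounded operators on a separable infinite-dimensional Hilbert space. *)

(* Defs.v *)
From HB Require Import structures.
From mathcomp Require Import all_boot all_order all_algebra.
From mathcomp Require Import all_classical all_reals all_analysis.
From mathcomp Require Import complex.

Set Implicit Arguments.
Unset Strict Implicit.
Unset Printing Implicit Defensive.

Import Order.TTheory GRing.Theory Num.Theory.
Import numFieldNormedType.Exports.

Local Open Scope classical_set_scope.
Local Open Scope ring_scope.
Local Open Scope complex_scope.

(* The pair (u, v) stands for u + iv. *)
Definition complexification (V : Type) : Type := (V * V)%type.

Section Complexification.
Variables (R : rcfType) (V : lmodType R).
Implicit Types (a b : R[i]) (x y : complexification V).

HB.instance Definition _ := GRing.Zmodule.on (complexification V).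

Definition complexification_scale a x : complexification V :=
  (complex.Re a *: x.1 - complex.Im a *: x.2,
   complex.Re a *: x.2 + complex.Im a *: x.1).

Lemma complexification_scaleA a b x :
  complexification_scale a (complexification_scale b x) =
  complexification_scale (a * b) x.
Proof.
case: a b x => [a a'] [b b'] [u v]; congr (_, _) => /=.
- rewrite scalerBr scalerDr !scalerA scalerBl scalerDl !opprD !addrA.
  by rewrite [LHS]addrAC; congr (_ + _); rewrite addrAC.
- rewrite scalerBr scalerDr !scalerA scalerBl scalerDl !addrA.
  by rewrite [LHS]addrAC; congr (_ + _); rewrite addrAC.
Qed.

Lemma complexification_scale1 : left_id 1 complexification_scale.
Proof.
by case=> u v; rewrite /complexification_scale /= !scale1r !scale0r subr0 addr0.
Qed.

Lemma complexification_scaleDr : right_distributive complexification_scale +%R.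
Proof.
move=> [a a'] [u v] [u' v']; congr (_, _); rewrite /= !scalerDr ?opprD;
  by rewrite addrACA.
Qed.

Lemma complexification_scaleDl x :
  {morph complexification_scale^~ x : a b / a + b}.
Proof.
by case: x => u v [a a'] [b b']; congr (_, _); rewrite /= !scalerDl ?opprD addrACA.
Qed.

HB.instance Definition _ := GRing.Zmodule_isLmodule.Build R[i]
  (complexification V) complexification_scaleA complexification_scale1
  complexification_scaleDr complexification_scaleDl.

Definition complexify (e : V) : complexification V := (e, 0).

(* Sesquilinear extension of a real inner product, linear in the first
   variable. *)
Definition complexification_dot (dot : {dot V for idfun}) x y : R[i] :=
  (dot x.1 y.1 + dot x.2 y.2) +i* (dot x.2 y.1 - dot x.1 y.2).

End Complexification.

(* A complex Hilbert space: a complete normed space whose norm comes from an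
   inner product, linear in the first variable. *)
Record hilbert (R : realType) := Hilbert {
  hilbert_sort :> completeNormedModType R[i];
  hdot : {dot hilbert_sort for Num.conj};
  hdot_norm : forall x : hilbert_sort, `|x| ^+ 2 = hdot x x }.

Section Operators.
Variables (R : realType) (H : hilbert R).
Implicit Types (x y : H -> H) (S : set (H -> H)).

Definition separable : Prop := exists2 D : set H, countable D & dense D.

Definition infinite_dimensional : Prop :=
  ~ exists s : seq H, forall v : H, exists c : 'I_(size s) -> R[i],
      v = \sum_i c i *: s`_i.

(* The algebra B(H), as a set of functions. *)
Definition bounded_op : set (H -> H) :=
  [set x | linear x /\ exists M : R[i], forall v, `|x v| <= M * `|v|].

(* The adjoint of a bounded operator; the default value is never used on
   bounded operators, which all have exactly one adjoint. *)
Definition adj x : H -> H :=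
  xget (cst 0) [set y | bounded_op y /\
                        forall u v, hdot H (x u) v = hdot H u (y v)].

Definition commutant S : set (H -> H) :=
  [set x | bounded_op x /\ forall y, S y -> x \o y = y \o x].

Definition bicommutant S : set (H -> H) := commutant (commutant S).

Definition faithful_on S (phi : (H -> H) -> R[i]) : Prop :=
  forall x, S x -> phi (adj x \o x) = 0 -> x = cst 0.

End Operators.
Arguments bounded_op {R} H.

(* [A] is *-isomorphic to the direct sum of [B] and [C]: there is a bijective
   *-homomorphism from [A] onto the pairs of elements of [B] and [C], with
   componentwise operations. Such a map is automatically normal when [A], [B]
   and [C] are von Neumann algebras. *)
Definition star_isomorphic_oplus (R : realType) (H K L : hilbert R)
    (A : set (H -> H)) (B : set (K -> K)) (C : set (L -> L)) : Prop :=
  exists pi : (H -> H) -> (K -> K) * (L -> L),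
  [/\ set_bij A (B `*` C) pi,
      forall (c : R[i]) x y, A x -> A y ->
        pi (fun v => c *: x v + y v) =
        ((fun v => c *: (pi x).1 v + (pi y).1 v),
         (fun v => c *: (pi x).2 v + (pi y).2 v)),
      forall x y, A x -> A y ->
        pi (x \o y) = ((pi x).1 \o (pi y).1, (pi x).2 \o (pi y).2) &
      forall x, A x -> pi (adj x) = (adj (pi x).1, adj (pi x).2)].

Section Fock.
Variables (R : realType) (V : vectType R) (dot : {dot V for idfun}).

(* A Hilbert space [F] presented as the t-deformed Fock space over the
   complexification of [V]: [tens [:: h1; ...; hk]] is the simple tensor
   h1 ⊗ ... ⊗ hk, and [tens [::]] is the vacuum. The inner products say that
   the closed span of the k-tensors is the Hilbert tensor power rescaled by
   t^(k-1), the vacuum is a unit vector (with [0.-1 = 0]), and distinct degrees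
   are orthogonal; [tens_total] says that the Hilbert sum of these subspaces is
   [F]. This determines [F] up to a unique unitary intertwining [tens]. *)
Record fock (t : R) := Fock {
  fock_space :> hilbert R;
  tens : seq (complexification V) -> fock_space;
  tens_multilinear : forall s1 s2,
    linear (fun h => tens (s1 ++ h :: s2));
  tens_dot : forall s1 s2,
    hdot fock_space (tens s1) (tens s2) =
    if size s1 == size s2 then
      t%:C ^+ (size s1).-1 *
      \prod_(h <- zip s1 s2) complexification_dot dot h.1 h.2
    else 0;
  tens_total :
    dense (range (fun w : seq (R[i] * seq (complexification V)) =>
                    \sum_(p <- w) p.1 *: tens p.2)) }.

Section Gaussian.
Variables (t : R) (F : fock t).

Definition vacuum : F := tens F [::].

(* The unique bounded operator with l Ω = e and
   l (h1 ⊗ ... ⊗ hk) = e ⊗ h1 ⊗ ... ⊗ hk. *)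
Definition creation (e : V) : F -> F :=
  xget (cst 0) [set l | bounded_op F l /\
                        forall s, l (tens F s) = tens F (complexify e :: s)].

Definition gaussian (e : V) : F -> F :=
  fun v => creation e v + adj (creation e) v.

Definition gaussian_algebra : set (F -> F) := bicommutant (range gaussian).

Definition vacuum_state (x : F -> F) : R[i] := hdot F (x vacuum) vacuum.

End Gaussian.
End Fock.
Arguments vacuum {R V dot t} F.
Arguments creation {R V dot t} F e.
Arguments gaussian {R V dot t} F e.
Arguments gaussian_algebra {R V dot t} F.
Arguments vacuum_state {R V dot t} F x.

(* Main.v *)
Require Import Defs.
From mathcomp Require Import all_boot all_order all_algebra.
From mathcomp Require Import all_classical all_reals all_analysis.
From mathcomp Require Import complex.
From mathcomp Require Import ring lra.

(** Fix an orthonormal basis [e_1, ..., e_n] of the real Hilbert space. The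
    words [w] in the letters [1, ..., n] index an orthonormal basis [E w] of the
    deformed Fock space, obtained by normalizing the tensors [e_w]. With
    [s = sqrt t], the generators [S i = l (e_i) + l (e_i)^*] act by
    [[
      S i (E [::])    = E [:: i]
      S i (E (j :: w)) = s E (i :: j :: w) + [i = j] kappa w E w
    ]]
    where [kappa w] is [1] on the empty word and [s] on the others. The
    generators [S1 i] for [t = 1] obey the same formulas with [s = 1], so [S i]
    is [s S1 i] up to an operator of finite rank. This small difference is what
    splits off a type I summand when [t] is far from 1.

    The summand [Gamma_1]. Tensoring on the right by the vector
    [sum_i e_i (x) e_i] almost commutes with the left operators, and
    [[
      T (E1 w) = kappa w E w + (s - 1/s) sum_i E (w i i)
    ]]
    exactly intertwines [s S1 i] with [S i] ([intertwiner]). The map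
    [M : E1 w |-> sum_i E (w i i)] is [sqrt n] times an isometry, and the other
    part of [T] pairs with the range of [M] like [s] times an isometry. Hence
    [T] is bounded below as soon as [|s - 1/s| n > s sqrt n], which is the
    hypothesis on [t] ([gap_gt0], [gap_condition]). Its range is then closed
    and reduces the generators; if [L] inverts [T] on this range and vanishes on
    the orthogonal complement, [x |-> L x T] maps the algebra of the [S i] to
    that of the [S1 i]. This map respects adjoints although [T] is not unitary,
    because [T T^*] commutes with the generators.

    The summand [B(l2)]. Let [Q] be the projection onto the range of [T] and
    [p = 1 - Q]. As [p] commutes with the generators and kills [T (E1 [::])],
    the vector [p Omega] is an eigenvector of [D = sum_i S i ^ 2], with
    eigenvalue [n + t / (1 - t)]. This eigenvalue is simple ([eigen_unique]):
    along the orbit of a vector under left tensoring by [sum_i e_i (x) e_i],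
    the coefficients of an eigenvector satisfy a linear recurrence of order two
    with roots [t / (1 - t)] and [n (1 - t) / t], and the hypothesis on [t]
    makes the second root exceed the growth rate [sqrt n] that the
    Cauchy-Schwarz inequality allows. An operator commuting with the generators
    therefore maps [p Omega] to a multiple of itself and, [Omega] being cyclic,
    acts as a scalar on the range of [p] ([commuting_scalar]). By the bicommutant
    description, the algebra contains [p] and every bounded operator on the
    range of [p]. That range is infinite-dimensional because there are two
    letters ([kernel_basis]), so it is unitarily equivalent to [l2], and
    [x |-> (U^* x U, L x T)] is the isomorphism ([generated_algebra_iso]).

    The vacuum state is not faithful: the range of [p] contains a nonzero vector
    orthogonal to [Omega], and the rank one operator on this vector belongs to
    the algebra and kills [Omega] ([vacuum_kernel]). *)

Set Implicit Arguments.
Unset Strict Implicit.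
Unset Printing Implicit Defensive.

Import Order.TTheory GRing.Theory Num.Theory.
Import numFieldNormedType.Exports.
Local Open Scope ring_scope.
Local Open Scope complex_scope.

Local Notation "''[' u , v ]" := (hdot _ u v) : ring_scope.

(** * Inner products *)

Section Inner.
Variables (R : realType) (H : hilbert R).
Implicit Types (u v w : H) (c : R[i]).

Lemma dotDl u v w : '[u + v, w] = '[u, w] + '[v, w].
Proof. exact: linearDl. Qed.
Lemma dotDr u v w : '[u, v + w] = '[u, v] + '[u, w].
Proof. exact: linearDr. Qed.
Lemma dotZl c u v : '[c *: u, v] = c * '[u, v].
Proof. exact: linearZl_LR. Qed.
Lemma dotZr c u v : '[u, c *: v] = Num.conj c * '[u, v].
Proof. exact: linearZr_LR. Qed.
Lemma dotNl u v : '[- u, v] = - '[u, v].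
Proof. exact: linearNl. Qed.
Lemma dotNr u v : '[u, - v] = - '[u, v].
Proof. exact: linearNr. Qed.
Lemma dotBl u v w : '[u - v, w] = '[u, w] - '[v, w].
Proof. exact: linearBl. Qed.
Lemma dotBr u v w : '[u, v - w] = '[u, v] - '[u, w].
Proof. exact: linearBr. Qed.
Lemma dot0l u : '[0, u] = 0.
Proof. exact: linear0l. Qed.
Lemma dot0r u : '[u, 0] = 0.
Proof. exact: linear0r. Qed.
Lemma dot_suml I (r : seq I) (P : pred I) (f : I -> H) v :
  '[\sum_(i <- r | P i) f i, v] = \sum_(i <- r | P i) '[f i, v].
Proof. exact: linear_sumlz. Qed.
Lemma dot_sumr I (r : seq I) (P : pred I) (f : I -> H) v :
  '[v, \sum_(i <- r | P i) f i] = \sum_(i <- r | P i) '[v, f i].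
Proof. exact: linear_sumr. Qed.
Lemma dotC u v : Num.conj '[u, v] = '[v, u].
Proof. by rewrite [RHS]hermC /= expr0 mul1r. Qed.
Lemma dot_ge0 u : 0 <= '[u, u].
Proof. exact: dnorm_ge0. Qed.
Lemma dot_eq0 u : ('[u, u] == 0) = (u == 0).
Proof. exact: dnorm_eq0. Qed.
Lemma dot_gt0 u : (0 < '[u, u]) = (u != 0).
Proof. exact: dnorm_gt0. Qed.
Lemma cauchy_schwarz u v : `|'[u, v]| ^+ 2 <= '[u, u] * '[v, v].
Proof.
have [->|v0] := eqVneq v 0; first by rewrite dot0r normr0 expr0n dot0l mulr0.
have b0 : 0 < '[v, v] by rewrite dot_gt0.
have := dot_ge0 ('[v, v] *: u - '[u, v] *: v).
rewrite dotBl !dotBr !dotZl !dotZr dotC normCK dotC.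
rewrite -(dotC v u) dotC.
set a := '[u, v]; set b := '[v, v]; set a' := '[v, u] => h.
have {h} : 0 <= b * ('[u, u] * b - a * a') by apply: le_trans h _;
  rewrite le_eqVlt; apply/orP; left; apply/eqP; ring.
by rewrite pmulr_rge0 // subr_ge0.
Qed.

Lemma dotDsqr u v : '[u + v, u + v] <= 2 * ('[u, u] + '[v, v]).
Proof.
rewrite -subr_ge0; have := dot_ge0 (u - v).
by rewrite !(dotDl, dotDr, dotNl, dotNr) => h; apply: le_trans h _;
  rewrite le_eqVlt; apply/orP; left; apply/eqP; ring.
Qed.

Lemma dot_inj u v : (forall w, '[u, w] = '[v, w]) -> u = v.
Proof.
move=> h; apply/eqP; rewrite -subr_eq0 -dot_eq0 dotBl h -dotBl subrr dot0l //.
Qed.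

Lemma dotZZ c u : '[c *: u, c *: u] = `|c| ^+ 2 * '[u, u].
Proof. by rewrite dotZl dotZr normCK mulrA. Qed.

End Inner.

(** * Limits in norm *)

Section Limits.
Variables (R : realType).
Local Notation C := R[i].

Definition vanishes (f : nat -> C) :=
  forall e : C, 0 < e -> exists N, forall k, (N <= k)%N -> `|f k| <= e.

Lemma vanishesD f g : vanishes f -> vanishes g -> vanishes (fun k => f k + g k).
Proof.
move=> hf hg e e0; have e20 : 0 < e / 2 by rewrite divr_gt0.
have [N1 h1] := hf _ e20; have [N2 h2] := hg _ e20.
exists (maxn N1 N2) => k; rewrite geq_max => /andP[k1 k2].
apply: le_trans (ler_normD _ _) _.
by rewrite [e]splitr lerD ?h1 ?h2.
Qed.

Lemma vanishesM f c : vanishes f -> vanishes (fun k => c * f k).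
Proof.
move=> hf e e0.
have c0 : 0 < `|c| + 1 by rewrite ltr_wpDl.
have [N hN] := hf (e / (`|c| + 1)) (divr_gt0 e0 c0).
exists N => k /hN; rewrite ler_pdivlMr // => h; rewrite normrM.
by apply: le_trans h; rewrite mulrC ler_wpM2l // lerDl.
Qed.

Lemma vanishes_le f g : (forall k, `|f k| <= `|g k|) -> vanishes g -> vanishes f.
Proof.
by move=> h hg e /hg[N hN]; exists N => k /hN; apply: le_trans.
Qed.

Lemma vanishes_eq f g : f =1 g -> vanishes g -> vanishes f.
Proof. by move=> h; apply: vanishes_le => k; rewrite h. Qed.

Lemma vanishes_sqr f : vanishes (fun k => `|f k| ^+ 2) -> vanishes f.
Proof.
move=> hf e e0; have [N hN] := hf (e ^+ 2) (exprn_gt0 _ e0).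
exists N => k /hN; rewrite ger0_norm ?exprn_ge0 // ler_pXn2r //.
by rewrite nnegrE ltW.
Qed.

Lemma vanishes_cst c : vanishes (fun=> c) -> c = 0.
Proof.
move=> h; apply/eqP; rewrite -normr_le0; apply/negPn/negP => c0.
have c0' : 0 < `|c| by rewrite normr_gt0; apply: contra c0 => /eqP ->; rewrite normr0.
have [N /(_ _ (leqnn N))] := h (`|c| / 2) (divr_gt0 c0' (ltr0n _ 2)).
rewrite ler_pdivlMr // => h1.
have : `|c| * 2 <= `|c| * 1 by rewrite mulr1.
by rewrite ler_pM2l // -[X in _ <= X]/(1%:R) ler_nat.
Qed.

Lemma vanishes_eventually f N : (forall k, (N <= k)%N -> f k = 0) -> vanishes f.
Proof. by move=> h e e0; exists N => k /h ->; rewrite normr0 ltW. Qed.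

(** Norm convergence is measured by the squared norm, so that every estimate
    below involves the inner product only. *)
Definition converges (H : hilbert R) (s : nat -> H) (l : H) :=
  vanishes (fun k => '[s k - l, s k - l]).

Lemma convergesD (H : hilbert R) (s s' : nat -> H) l l' :
  converges s l -> converges s' l' -> converges (fun k => s k + s' k) (l + l').
Proof.
move=> h h'; have := vanishesM 2 (vanishesD h h'); apply: vanishes_le => k.
rewrite !ger0_norm ?mulr_ge0 ?addr_ge0 ?dot_ge0 //.
by rewrite opprD addrACA dotDsqr.
Qed.

Lemma convergesZ (H : hilbert R) (s : nat -> H) l c :
  converges s l -> converges (fun k => c *: s k) (c *: l).
Proof.
move=> h; have := vanishesM (`|c| ^+ 2) h; apply: vanishes_eq => k.
by rewrite -scalerBr dotZZ.
Qed.

Lemma converges_dot (H : hilbert R) (s : nat -> H) l u :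
  converges s l -> vanishes (fun k => '[s k, u] - '[l, u]).
Proof.
move=> h; apply: vanishes_sqr.
apply: vanishes_le (vanishesM '[u, u] h) => k.
rewrite normrX normr_id [X in _ <= X]ger0_norm ?mulr_ge0 ?dot_ge0 //.
by rewrite -dotBl mulrC; exact: cauchy_schwarz.
Qed.

Lemma converges_uniq (H : hilbert R) (s : nat -> H) l l' :
  converges s l -> converges s l' -> l = l'.
Proof.
move=> h h'; apply: dot_inj => u; apply/eqP; rewrite -subr_eq0; apply/eqP.
apply: vanishes_cst; apply:
  vanishes_eq (vanishesD (converges_dot u h')
    (vanishesM (-1) (converges_dot u h))) => k.
by rewrite /=; ring.
Qed.

(** Testing the sequence against its limit [l]: the Cauchy-Schwarz inequality
    bounds [|<s k, l>| ^ 2] by [B <l, l>], and [<s k, l>] tends to [<l, l>]. *)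
Lemma converges_le (H : hilbert R) (s : nat -> H) l B :
  converges s l -> (forall k, '[s k, s k] <= B) -> '[l, l] <= B.
Proof.
move=> h hB.
have B0 : 0 <= B by apply: le_trans (dot_ge0 _) (hB 0%N).
have [->|l0] := eqVneq l 0; first by rewrite dot0l.
have ql : 0 < '[l, l] by rewrite dot_gt0.
rewrite real_leNgt ?ger0_real ?dot_ge0 //; apply/negP => hlt.
(* If [B < <l, l>], then [<l, l> - d] is their mean, which exceeds the
   geometric mean obtained in the limit. *)
pose d := ('[l, l] - B) / 2.
have d0 : 0 < d by rewrite divr_gt0 // subr_gt0.
have ed : 0 < d / '[l, l] * d by rewrite mulr_gt0 // divr_gt0.
have [N /(_ _ (leqnn N)) hN] := converges_dot l h d0.
have h1 : '[l, l] - d <= `|'[s N, l]|.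
  rewrite lerBlDr -[X in X <= _](ger0_norm (dot_ge0 l)).
  rewrite -lerBlDl; apply: le_trans hN; rewrite distrC; exact: lerB_dist.
have h2 : `|'[s N, l]| ^+ 2 <= B * '[l, l].
  by apply: le_trans (cauchy_schwarz _ _) _; rewrite ler_pM2r.
have dl : '[l, l] - d = ('[l, l] + B) / 2 by rewrite /d; field.
have : (('[l, l] + B) / 2) ^+ 2 <= B * '[l, l].
  apply: le_trans h2; rewrite -dl ler_pXn2r // nnegrE.
  by rewrite dl divr_ge0 // addr_ge0 // dot_ge0.
rewrite -subr_ge0.
have -> : B * '[l, l] - (('[l, l] + B) / 2) ^+ 2 = - d ^+ 2 by rewrite /d; field.
by rewrite oppr_ge0 => /le_lt_trans /(_ (exprn_gt0 2 d0)); rewrite ltxx.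
Qed.

Lemma norm_sqr (H : hilbert R) (v : H) : `|v| ^+ 2 = '[v, v].
Proof. exact: hdot_norm. Qed.

Lemma hilbert_complete (H : hilbert R) (s : nat -> H) :
  (forall e : C, 0 < e -> exists N, forall m k, (N <= m)%N -> (m <= k)%N ->
     '[s k - s m, s k - s m] <= e) ->
  exists l, converges s l.
Proof.
move=> hs.
have : cauchy (s @ \oo)%classic.
  apply/cauchy_exP => e e0.
  have e20 : 0 < (e / 2) ^+ 2 by rewrite exprn_gt0 // divr_gt0.
  have [N hN] := hs _ e20.
  exists (s N).
  exists N => // k /= Nk.
  rewrite -ball_normE /=; rewrite distrC.
  have : `|s k - s N| <= e / 2.
    have e2 : 0 <= e / 2 by rewrite divr_ge0 ?ler0n // ltW.
    by rewrite -(@ler_pXn2r _ 2) ?nnegrE // norm_sqr; apply: hN.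
  by move=> /le_lt_trans; apply; rewrite ltr_pdivrMr // ltr_pMr // ltr1n.
move=> /cauchy_cvgP /cvg_ex[l hl]; exists l => e e0.
have e1 : 0 < sqrtC e by rewrite sqrtC_gt0.
have /cvgrPdist_le /(_ _ e1) [N _ hN] := hl.
exists N => k /hN /=; rewrite distrC => h.
rewrite ger0_norm ?dot_ge0 // -norm_sqr -[e]sqrtCK.
by rewrite ler_pXn2r // nnegrE // ltW.
Qed.

(** Past an index [N] where [a N] is within [e] of the supremum, no increment
    exceeds [e]. *)
Lemma incr_cauchy (a : nat -> C) (B : C) :
  (forall k, 0 <= a k) -> (forall m k, (m <= k)%N -> a m <= a k) ->
  (forall k, a k <= B) ->
  forall e, 0 < e -> exists N, forall m k, (N <= m)%N -> (m <= k)%N -> a k - a m <= e.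
Proof.
move=> a0 am aB e e0.
have B0 : 0 <= B := le_trans (a0 0%N) (aB 0%N).
pose r k := complex.Re (a k).
have ra k : a k = (r k)%:C by rewrite /r RRe_real // ger0_real.
pose S := [set r k | k in [set: nat]]%classic.
have eE : e = (complex.Re e)%:C by rewrite RRe_real // ger0_real // ltW.
have BE : B = (complex.Re B)%:C by rewrite RRe_real // ger0_real.
have supS : has_sup S.
  split; first by exists (r 0%N); exists 0%N.
  by exists (complex.Re B) => _ [k _ <-]; rewrite -lecR -ra -BE.
have e0' : 0 < complex.Re e by rewrite -ltcR -eE.
have [_ [N _ <-] hN] := sup_adherent e0' supS.
exists N => m k Nm mk; rewrite eE !ra -rmorphB lecR.
have h1 : r k <= sup S by apply: sup_upper_bound => //; exists k.
have h2 : r N <= r m by rewrite -lecR -!ra am.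
lra.
Qed.

(** The usual case is an orthogonal series: the squared norms of its increments
    are the increments of the scalar series [a] of squared norms. *)
Lemma dominated_cvg (H : hilbert R) (s : nat -> H) (a : nat -> C) (B D : C) :
  (forall k, 0 <= a k) -> (forall m k, (m <= k)%N -> a m <= a k) ->
  (forall k, a k <= B) -> 0 <= D ->
  (forall m k, (m <= k)%N -> '[s k - s m, s k - s m] <= D * (a k - a m)) ->
  exists l, converges s l.
Proof.
move=> a0 am aB D0 h; apply: hilbert_complete => e e0.
have D1 : 0 < D + 1 by rewrite ltr_wpDl.
have [N hN] := incr_cauchy a0 am aB (divr_gt0 e0 D1).
exists N => m k Nm mk; apply: le_trans (h _ _ mk) _.
have := hN _ _ Nm mk; rewrite ler_pdivlMr //; apply: le_trans.
by rewrite mulrC ler_wpM2l ?lerDl // subr_ge0 am.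
Qed.

End Limits.

(** * Orthogonal sequences and Fourier expansions *)

(** Orthogonalization without normalization, so that no square root is needed
    and both the complex inner product of a Hilbert space and a real inner
    product are covered. A vector [y i] with [B (y i) (y i) = 0] vanishes, and
    the convention [0 / 0 = 0] then removes it from the projections. *)
Lemma gram_schmidt (F : fieldType) (U : lmodType F) (B : U -> U -> F)
    (linB : forall c u v w, B (c *: u + v) w = c * B u w + B v w)
    (symB : forall u v, B u v = 0 -> B v u = 0)
    (defB : forall u, B u u = 0 -> u = 0) (x : nat -> U) :
  exists y : nat -> U,
    (forall i j, i != j -> B (y i) (y j) = 0) /\
    (forall k, exists c : nat -> F, x k = y k + \sum_(i < k) c i *: y i).
Proof.
pose step (s : seq U) := x (size s) - \sum_(z <- s) (B (x (size s)) z / B z z) *: z.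
pose gs := fix gs k := if k is k'.+1 then rcons (gs k') (step (gs k')) else [::].
pose y k := step (gs k).
have gsE k : gs k = mkseq y k.
  by elim: k => // k IH; rewrite mkseqS -IH.
have yE k : y k = x k - \sum_(i < k) (B (x k) (y i) / B (y i) (y i)) *: y i.
  rewrite {1}/y /step gsE size_mkseq; congr (_ - _).
  by rewrite big_map -{1}[k]subn0 -/(index_iota 0 k) big_mkord.
have B0 w : B 0 w = 0.
  have := linB (-1) 0 0 w; rewrite scaleN1r oppr0 addr0 mulN1r => h.
  by move/eqP: h; rewrite addrC subrr => /eqP.
have BN c u w : B (c *: u) w = c * B u w.
  by have := linB c u 0 w; rewrite !addr0 B0 addr0.
have BB u v w : B (u - v) w = B u w - B v w.
  by have := linB (-1) v u w; rewrite scaleN1r addrC mulN1r [in RHS]addrC => ->.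
have Bsum m (u : 'I_m -> U) w : B (\sum_(i < m) u i) w = \sum_(i < m) B (u i) w.
  apply: (big_morph (B^~ w)) => [u1 u2|]; last exact: B0.
  by rewrite -[u1 in LHS]scale1r linB mul1r.
have yo k : forall j, (j < k)%N -> B (y k) (y j) = 0.
  elim/ltn_ind: k => k IH j jk.
  rewrite yE BB Bsum (bigD1 (Ordinal jk)) //= BN big1 ?addr0; last first.
    move=> i ij; rewrite BN; case: (ltngtP i j) => ij'; last by case/negP: ij; apply/eqP/val_inj.
      by rewrite (symB _ _ (IH _ jk _ ij')) mulr0.
    by rewrite (IH _ (ltn_ord i) _ ij') mulr0.
  have [y0|y0] := eqVneq (B (y j) (y j)) 0; last by rewrite divfK // subrr.
  rewrite y0 mulr0 subr0 (defB _ y0); apply: symB; exact: B0.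
exists y; split.
  move=> i j; case: (ltngtP i j) => // ij _; last exact: yo.
  by apply: symB; apply: yo.
move=> k; exists (fun i => B (x k) (y i) / B (y i) (y i)).
by rewrite {1}yE subrK.
Qed.

Section OrthoSeq.
Variables (R : realType).
Local Notation C := R[i].

Definition ortho_family (H : hilbert R) (I : eqType) (f : I -> H) :=
  forall i j, i != j -> '[f i, f j] = 0.

(** An orthonormal family padded with zeros. The padding allows
    orthogonalization of dependent vectors and families indexed by arbitrary
    countable types. *)
Definition ortho01 (H : hilbert R) (f : nat -> H) :=
  ortho_family f /\ forall i, '[f i, f i] = (f i != 0)%:R.

(** Density of the span, expressed through the orthogonal complement. *)
Definition total_family (H : hilbert R) (I : Type) (f : I -> H) :=
  forall v, (forall i, '[v, f i] = 0) -> v = 0.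

Definition has_onb (H : hilbert R) := exists f : nat -> H, ortho01 f /\ total_family f.

Lemma pythagoras (H : hilbert R) (I : eqType) (f : I -> H) (c : I -> C) r :
  ortho_family f -> uniq r ->
  '[\sum_(i <- r) c i *: f i, \sum_(i <- r) c i *: f i] =
  \sum_(i <- r) `|c i| ^+ 2 * '[f i, f i].
Proof.
move=> of_f ur; rewrite dot_suml big_seq [RHS]big_seq; apply: eq_bigr => i ir.
rewrite dotZl dot_sumr (bigD1_seq i) //= big1 ?addr0.
  by rewrite dotZr mulrA normCK.
by move=> j ji; rewrite dotZr of_f ?mulr0 // eq_sym.
Qed.

Lemma ortho01_coef (H : hilbert R) (f : nat -> H) v i : ortho01 f ->
  '[v, f i] * '[f i, f i] = '[v, f i].
Proof.
by move=> [_ ->]; have [->|] := eqVneq (f i) 0; rewrite ?dot0r ?mul0r ?mulr1.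
Qed.

Lemma ortho01_coef_sqr (H : hilbert R) (f : nat -> H) v i : ortho01 f ->
  `|'[v, f i]| ^+ 2 * '[f i, f i] = `|'[v, f i]| ^+ 2.
Proof.
move=> [_ ->]; have [->|] := eqVneq (f i) 0; rewrite ?mulr1 //.
by rewrite dot0r normr0 expr0n mul0r.
Qed.

(** Partial sums of the operator that sends [f k] to [g k]; for [g = f] these
    are partial Fourier sums. *)
Definition fourier (H K : hilbert R) (f : nat -> H) (g : nat -> K) N v :=
  \sum_(0 <= k < N) '[v, f k] *: g k.

(** The squared distance from [v] to its partial Fourier sum is nonnegative. *)
Lemma bessel (H : hilbert R) (f : nat -> H) v N : ortho01 f ->
  \sum_(0 <= k < N) `|'[v, f k]| ^+ 2 <= '[v, v].
Proof.
move=> onf; have := dot_ge0 (v - fourier f f N v).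
have h1 : '[fourier f f N v, fourier f f N v] = \sum_(0 <= k < N) `|'[v, f k]| ^+ 2.
  rewrite pythagoras ?iota_uniq //; last exact: (proj1 onf).
  by apply: eq_bigr => i _; rewrite ortho01_coef_sqr.
have h2 : '[fourier f f N v, v] = \sum_(0 <= k < N) `|'[v, f k]| ^+ 2.
  by rewrite dot_suml; apply: eq_bigr => i _; rewrite dotZl -[X in _ * X]dotC normCK.
rewrite dotBl !dotBr h1 h2 -[X in _ - X - _]dotC h2.
have s0 : 0 <= \sum_(0 <= k < N) `|'[v, f k]| ^+ 2.
  by apply: sumr_ge0 => i _; rewrite exprn_ge0.
by rewrite geC0_conj // subrr subr0 subr_ge0.
Qed.

(** A Bessel family is one whose synthesis operator [c |-> sum_k c k g k] is
    bounded on finitely supported sequences. *)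
Definition bessel_family (K : hilbert R) (g : nat -> K) (B : C) :=
  0 <= B /\ forall (c : nat -> C) m N,
    '[\sum_(m <= k < N) c k *: g k, \sum_(m <= k < N) c k *: g k] <=
      B * \sum_(m <= k < N) `|c k| ^+ 2.

Lemma bessel_family_ortho (K : hilbert R) (g : nat -> K) B :
  ortho_family g -> 0 <= B -> (forall k, '[g k, g k] <= B) -> bessel_family g B.
Proof.
move=> og B0 hB; split => // c m N.
rewrite pythagoras ?iota_uniq // mulr_sumr; apply: ler_sum => i _.
by rewrite mulrC ler_wpM2r // exprn_ge0.
Qed.

Lemma ortho01_bessel (H : hilbert R) (f : nat -> H) : ortho01 f -> bessel_family f 1.
Proof.
move=> onf; apply: bessel_family_ortho => //; first by case: onf.
by move=> k; rewrite onf.2; case: (f k != 0); rewrite ?ler01 ?lexx.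
Qed.

(** The coefficients are square summable by Bessel's inequality, and the Bessel
    bound of [g] transfers the Cauchy property of the series of their squares. *)
Lemma fourier_cvg (H K : hilbert R) (f : nat -> H) (g : nat -> K) B v :
  ortho01 f -> bessel_family g B -> exists l, converges (fun N => fourier f g N v) l.
Proof.
move=> onf [B0 hg].
pose a N := \sum_(0 <= k < N) `|'[v, f k]| ^+ 2.
have aD m k : (m <= k)%N -> a k - a m = \sum_(m <= i < k) `|'[v, f i]| ^+ 2.
  by move=> mk; rewrite /a (big_cat_nat (leq0n m) mk) //= addrC addrK.
apply: (@dominated_cvg _ _ _ a '[v, v] B) => //.
- by move=> k; rewrite sumr_ge0 // => i _; rewrite exprn_ge0.
- move=> m k mk; rewrite -subr_ge0 aD // sumr_ge0 // => i _; by rewrite exprn_ge0.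
- by move=> k; apply: bessel.
- move=> m k mk; rewrite aD //.
  have -> : fourier f g k v - fourier f g m v = \sum_(m <= i < k) '[v, f i] *: g i.
    by rewrite /fourier (big_cat_nat (leq0n m) mk) //= addrC addrK.
  exact: hg.
Qed.

(** The sum of the Fourier series has the same coefficients as [v], hence
    differs from [v] by a vector orthogonal to a total family. *)
Lemma fourier_expand (H : hilbert R) (f : nat -> H) v :
  ortho01 f -> total_family f -> converges (fun N => fourier f f N v) v.
Proof.
move=> onf tf.
have bf : bessel_family f 1.
  exact: ortho01_bessel.
have [l hl] := fourier_cvg v onf bf.
suff E : v = l by rewrite {2}E.
apply/eqP; rewrite -subr_eq0; apply/eqP; apply: tf => j.
apply: vanishes_cst; apply:
  vanishes_eq (vanishesD (converges_dot (f j) hl)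
    (@vanishes_eventually _ (fun N => '[v, f j] - '[fourier f f N v, f j]) j.+1 _)) => /=.
  by move=> k; rewrite dotBl; ring.
move=> k jk; apply/eqP; rewrite subr_eq0; apply/eqP.
rewrite dot_suml (bigD1_seq j) ?iota_uniq ?mem_index_iota //= dotZl.
by rewrite (ortho01_coef _ _ onf) big1 ?addr0 // => i ij; rewrite dotZl onf.1 ?mulr0.
Qed.

End OrthoSeq.

(** * Adjoint pairs of bounded operators *)

Section Operators.
Variables (R : realType).
Local Notation C := R[i].
Implicit Types (H K L : hilbert R).

Definition bounded_map H K (A : H -> K) :=
  exists M : C, 0 <= M /\ forall v, '[A v, A v] <= M * '[v, v].

(** Boundedness of [A] alone is required: it passes to [B], and the second
    condition forces both maps to be linear. *)
Definition adjoint H K (A : H -> K) (B : K -> H) :=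
  bounded_map A /\ forall u v, '[A u, v] = '[u, B v].

Lemma dot_adjoint_linear H K (A : H -> K) (B : K -> H) :
  (forall u v, '[A u, v] = '[u, B v]) -> linear A.
Proof.
move=> h c u v; apply: dot_inj => w.
by rewrite !(dotDl, dotZl, h).
Qed.

Lemma adjoint_linear H K (A : H -> K) B : adjoint A B -> linear A.
Proof. by case=> _; apply: dot_adjoint_linear. Qed.

(** By Cauchy-Schwarz, [|B v| ^ 4 = |<A (B v), v>| ^ 2] is at most
    [M |B v| ^ 2 |v| ^ 2]. *)
Lemma adjoint_bounded H K (A : H -> K) B : adjoint A B -> bounded_map B.
Proof.
case=> [[M [M0 hM]] h]; exists M; split => // v.
have h1 : '[B v, B v] ^+ 2 <= (M * '[B v, B v]) * '[v, v].
  have := cauchy_schwarz (A (B v)) v; rewrite h ger0_norm ?dot_ge0 // => /le_trans; apply.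
  by rewrite ler_wpM2r ?dot_ge0.
have [B0|B0] := eqVneq (B v) 0.
  by rewrite B0 dot0l mulr_ge0 ?dot_ge0.
have p : 0 < '[B v, B v] by rewrite dot_gt0.
by rewrite -(ler_pM2l p) -expr2; apply: le_trans h1 _; rewrite mulrAC mulrC.
Qed.

Lemma adjoint_sym H K (A : H -> K) B : adjoint A B -> adjoint B A.
Proof.
move=> h; split; first exact: adjoint_bounded h.
by move=> u v; rewrite -dotC -h.2 dotC.
Qed.

Lemma adjoint_id H : adjoint (@id H) id.
Proof. by split=> //; exists 1; split=> // v; rewrite mul1r. Qed.

Lemma adjoint_comp H K L (A : H -> K) A' (B : K -> L) B' :
  adjoint A A' -> adjoint B B' -> adjoint (B \o A) (A' \o B').
Proof.
move=> [[M [M0 hM]] hA] [[N [N0 hN]] hB]; split; last by move=> u v; rewrite /= hB hA.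
exists (N * M); split; first exact: mulr_ge0.
by move=> v; apply: le_trans (hN _) _; rewrite -mulrA ler_wpM2l.
Qed.

Lemma adjointD H K (A : H -> K) A' B B' :
  adjoint A A' -> adjoint B B' -> adjoint (fun v => A v + B v) (fun v => A' v + B' v).
Proof.
move=> [[M [M0 hM]] hA] [[N [N0 hN]] hB].
split; last by move=> u v; rewrite dotDl dotDr hA hB.
exists (2 * (M + N)); split; first by rewrite mulr_ge0 ?addr_ge0.
move=> v; apply: le_trans (dotDsqr _ _) _.
by rewrite -mulrA ler_wpM2l // mulrDl lerD.
Qed.

Lemma adjointZ H K (A : H -> K) A' c :
  adjoint A A' -> adjoint (fun v => c *: A v) (fun v => Num.conj c *: A' v).
Proof.
move=> [[M [M0 hM]] hA]; split; last by move=> u v; rewrite dotZl dotZr conjCK hA.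
exists (`|c| ^+ 2 * M); split; first by rewrite mulr_ge0 // exprn_ge0.
by move=> v; rewrite dotZZ -[X in _ <= X]mulrA ler_wpM2l // exprn_ge0.
Qed.

Lemma adjoint0 H K : adjoint (fun _ : H => 0 : K) (fun _ => 0).
Proof.
by split=> [|u v]; [exists 0; split=> // v|]; rewrite ?dot0l ?dot0r ?mul0r.
Qed.

Lemma adjoint_sum H K (I : Type) (r : seq I) (A : I -> H -> K) A' :
  (forall i, adjoint (A i) (A' i)) ->
  adjoint (fun v => \sum_(i <- r) A i v) (fun v => \sum_(i <- r) A' i v).
Proof.
move=> h; elim: r => [|i r IH].
  rewrite (_ : (fun v => _) = fun=> 0); last by apply/funext => v; rewrite big_nil.
  rewrite [X in adjoint _ X](_ : _ = fun=> 0); last by apply/funext => v; rewrite big_nil.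
  exact: adjoint0.
rewrite (_ : (fun v => _) = fun v => A i v + \sum_(i <- r) A i v);
  last by apply/funext => v; rewrite big_cons.
rewrite [X in adjoint _ X](_ : _ = fun v => A' i v + \sum_(i <- r) A' i v);
  last by apply/funext => v; rewrite big_cons.
exact: adjointD.
Qed.

Lemma adjoint_rank1 H K (a : K) (b : H) :
  adjoint (fun v => '[v, b] *: a) (fun v => '[v, a] *: b).
Proof.
split; last by move=> u v; rewrite dotZl dotZr dotC mulrC.
exists ('[b, b] * '[a, a]); split; first by rewrite mulr_ge0 ?dot_ge0.
move=> v; rewrite dotZZ [X in _ <= X]mulrAC ler_wpM2r ?dot_ge0 // [X in _ <= X]mulrC.
exact: cauchy_schwarz.
Qed.

(** The difference of the two operators has an adjoint, whose values are
    orthogonal to the family. *)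
Lemma eq_on_total H K (I : Type) (f : I -> H) (A B : H -> K) A' B' :
  total_family f -> (forall u v, '[A u, v] = '[u, A' v]) ->
  (forall u v, '[B u, v] = '[u, B' v]) -> (forall i, A (f i) = B (f i)) -> A = B.
Proof.
move=> tf hA hB AB; apply/funext => v; apply: dot_inj => w.
rewrite hA hB; apply/eqP; rewrite -subr_eq0 -dotBr.
suff -> : A' w - B' w = 0 by rewrite dot0r.
by apply: tf => i; rewrite -dotC dotBr -hA -hB AB subrr rmorph0.
Qed.

Lemma linZ H K (A : H -> K) : linear A -> forall c u, A (c *: u) = c *: A u.
Proof.
move=> lA c u; have A0 : A 0 = 0.
  by have := lA (-1) 0 0; rewrite scaler0 addr0 scaleN1r addNr.
by have := lA c u 0; rewrite !addr0 A0 addr0.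
Qed.

Lemma linD H K (A : H -> K) : linear A -> forall u v, A (u + v) = A u + A v.
Proof. by move=> lA u v; have := lA 1 u v; rewrite !scale1r. Qed.

Lemma lin0 H K (A : H -> K) : linear A -> A 0 = 0.
Proof. by move=> lA; rewrite -(scale0r 0) linZ // scale0r. Qed.

Lemma linB H K (A : H -> K) : linear A -> forall u v, A (u - v) = A u - A v.
Proof. by move=> lA u v; rewrite linD // -scaleN1r linZ // scaleN1r. Qed.

Lemma lin_sum H K (A : H -> K) I (r : seq I) P (f : I -> H) : linear A ->
  A (\sum_(i <- r | P i) f i) = \sum_(i <- r | P i) A (f i).
Proof. by move=> lA; apply: (big_morph A (linD lA) (lin0 lA)). Qed.

Lemma pointwise_limit H K (A_ : nat -> H -> K) (M : C) :
  (forall N, linear (A_ N)) -> (forall v, exists l, converges (fun N => A_ N v) l) ->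
  0 <= M -> (forall N v, '[A_ N v, A_ N v] <= M * '[v, v]) ->
  exists A : H -> K, [/\ linear A, bounded_map A & forall v, converges (fun N => A_ N v) (A v)].
Proof.
move=> lA /choice[A hA] M0 hM; exists A; split => //.
- move=> c u v; apply: converges_uniq (hA _) _.
  have := convergesD (convergesZ c (hA u)) (hA v).
  by apply: vanishes_eq => k; rewrite /= lA.
- by exists M; split => // v; apply: converges_le (hA v) _.
Qed.

Lemma fourier_lin H K (f : nat -> H) (g : nat -> K) N : linear (fourier f g N).
Proof.
move=> c u v; rewrite /fourier scaler_sumr -big_split; apply: eq_bigr => i _ /=.
by rewrite dotDl dotZl scalerDl scalerA.
Qed.

Lemma bounded_converges H K (A : H -> K) s l : linear A -> bounded_map A -> converges s l ->
  converges (fun N => A (s N)) (A l).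
Proof.
move=> lA [M [M0 hM]] hs; apply: vanishes_le (vanishesM M hs) => k.
rewrite !ger0_norm ?mulr_ge0 ?dot_ge0 //.
by rewrite -linB.
Qed.

(** The adjoint sends [u] to [sum_k <u, A (f k)> f k]. If [v] denotes a partial
    sum, its squared norm is at most [<A v, u>]; boundedness of [A] then bounds
    the coefficients uniformly, and the series converges. *)
Lemma adjoint_exists H K (A : H -> K) : has_onb H -> linear A -> bounded_map A ->
  exists B, adjoint A B.
Proof.
move=> [f [onf tf]] lA bA; case: (bA) => M [M0 hM].
have gB : bessel_family f 1.
  exact: ortho01_bessel.
pose B_ N (u : K) := \sum_(0 <= k < N) '[u, A (f k)] *: f k.
have linB_ N : linear (B_ N).
  move=> c u v; rewrite /B_ scaler_sumr -big_split; apply: eq_bigr => i _ /=.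
  by rewrite dotDl dotZl scalerDl scalerA.
have qB N u : '[B_ N u, B_ N u] <= \sum_(0 <= k < N) `|'[u, A (f k)]| ^+ 2.
  by have := gB.2 (fun k => '[u, A (f k)]) 0%N N; rewrite mul1r.
have sumB N u : \sum_(0 <= k < N) `|'[u, A (f k)]| ^+ 2 <= M * '[u, u].
  set s := \sum_(_ <= _ < _) _.
  have s0 : 0 <= s by apply: sumr_ge0 => i _; rewrite exprn_ge0.
  have sE : s = '[A (B_ N u), u].
    rewrite lin_sum // dot_suml; apply: eq_bigr => i _.
    by rewrite linZ // dotZl -[X in _ * X]dotC normCK.
  have h1 : s ^+ 2 <= (M * s) * '[u, u].
    rewrite -[X in X ^+ 2](ger0_norm s0) sE; apply: le_trans (cauchy_schwarz _ _) _.
    rewrite ler_wpM2r ?dot_ge0 //; apply: le_trans (hM _) _.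
    by rewrite -sE ler_wpM2l // qB.
  have [->|sn0] := eqVneq s 0; first by rewrite mulr_ge0 ?dot_ge0.
  have p : 0 < s by rewrite lt_def sn0.
  by rewrite -(ler_pM2l p) -expr2; apply: le_trans h1 _; rewrite mulrAC mulrC.
have cvgB u : exists l, converges (fun N => B_ N u) l.
  pose a N := \sum_(0 <= k < N) `|'[u, A (f k)]| ^+ 2.
  have aD m k : (m <= k)%N -> a k - a m = \sum_(m <= i < k) `|'[u, A (f i)]| ^+ 2.
    by move=> mk; rewrite /a (big_cat_nat (leq0n m) mk) //= addrC addrK.
  apply: (@dominated_cvg _ _ _ a (M * '[u, u]) 1) => //.
  - by move=> k; rewrite sumr_ge0 // => i _; rewrite exprn_ge0.
  - move=> m k mk; rewrite -subr_ge0 aD // sumr_ge0 // => i _; by rewrite exprn_ge0.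
  - by move=> k; apply: sumB.
  - move=> m k mk; rewrite aD //.
    have -> : B_ k u - B_ m u = \sum_(m <= i < k) '[u, A (f i)] *: f i.
      by rewrite /B_ (big_cat_nat (leq0n m) mk) //= addrC addrK.
    exact: gB.2.
have [B [_ _ BE]] := pointwise_limit linB_ cvgB M0 (fun N v => le_trans (qB N v) (sumB N v)).
exists B; split => // u v.
apply/eqP; rewrite -subr_eq0; apply/eqP; apply: vanishes_cst.
have h1 := converges_dot v (bounded_converges lA bA (fourier_expand u onf tf)).
have h2 := converges_dot u (BE v).
have h2' : vanishes (fun k => '[u, B_ k v] - '[u, B v]).
  by apply: vanishes_le h2 => k; rewrite -!dotBl -dotBr -dotC norm_conjC.
apply: vanishes_eq (vanishesD (vanishesM (-1) h1) h2') => k /=.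
have -> : '[A (fourier f f k u), v] = '[u, B_ k v].
  rewrite /fourier lin_sum // dot_suml dot_sumr; apply: eq_bigr => i _.
  by rewrite linZ // dotZl dotZr dotC mulrC.
by ring.
Qed.

(** An operator may be prescribed on an orthonormal sequence by any Bessel
    family; extending it by zero on the orthogonal complement makes it unique. *)
Lemma bessel_extension H K (f : nat -> H) (g : nat -> K) B :
  has_onb H -> ortho01 f -> bessel_family g B -> (forall k, f k = 0 -> g k = 0) ->
  exists A : H -> K, [/\ exists A', adjoint A A', forall k, A (f k) = g k,
    forall v, (forall k, '[v, f k] = 0) -> A v = 0 &
    forall v, converges (fun N => fourier f g N v) (A v)].
Proof.
move=> obH onf gB fg0.
have qA N v : '[fourier f g N v, fourier f g N v] <= B * '[v, v].
  apply: le_trans (gB.2 _ _ _) _; rewrite ler_wpM2l ?gB.1 //; exact: bessel.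
have [A [lA bA AE]] := pointwise_limit (fourier_lin f g) (fun v => fourier_cvg v onf gB) gB.1 qA.
exists A; split.
- exact: adjoint_exists.
- move=> k; apply: converges_uniq (AE _) _; apply: (@vanishes_eventually _ _ k.+1) => N kN.
  rewrite (_ : fourier _ _ _ _ = g k) ?subrr ?dot0l //.
  rewrite /fourier (bigD1_seq k) ?iota_uniq ?mem_index_iota //= big1; last first.
    by move=> i ik; rewrite onf.1 ?scale0r // eq_sym.
  rewrite addr0 onf.2; have [f0|_] := eqVneq (f k) 0; last by rewrite scale1r.
  by rewrite fg0 // scaler0.
- move=> v hv; apply: converges_uniq (AE _) _; apply: (@vanishes_eventually _ _ 0) => N _.
  by rewrite /fourier big1 ?subr0 ?dot0l // => i _; rewrite hv scale0r.
- exact: AE.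
Qed.

End Operators.

(** * Projections, isometries and orthonormal bases *)

Section Bases.
Variables (R : realType).
Local Notation C := R[i].
Implicit Types (H K L : hilbert R).

(** The projection onto the closed span of [g] is the sum of the Fourier series
    along [g]. *)
Lemma projection_exists H (g : nat -> H) : has_onb H -> ortho01 g ->
  exists Q : H -> H, [/\ adjoint Q Q, forall k, Q (g k) = g k,
    forall v, (forall k, '[v, g k] = 0) -> Q v = 0 &
    forall v k, '[Q v, g k] = '[v, g k]].
Proof.
move=> obH ong.
have gB : bessel_family g 1.
  exact: ortho01_bessel.
have [Q [[Q' QQ'] Qg Q0 Qto]] := bessel_extension obH ong gB (fun k h => h).
have lQ := adjoint_linear QQ'.
have Qort v x : (forall k, '[x, g k] = 0) -> '[Q v, x] = 0.
  move=> hx; have h := converges_dot x (Qto v).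
  suff : - '[Q v, x] = 0 by move/eqP; rewrite oppr_eq0 => /eqP.
  apply: vanishes_cst; apply: vanishes_eq h => k.
  rewrite /fourier dot_suml big1 ?sub0r // => i _.
  by rewrite dotZl -[X in _ * X]dotC hx rmorph0 mulr0.
have Qcoef v j : '[Q v, g j] = '[v, g j].
  have h := converges_dot (g j) (Qto v).
  apply/eqP; rewrite -subr_eq0; apply/eqP; apply: vanishes_cst.
  apply:
    vanishes_eq (vanishesD (vanishesM (-1) h)
      (@vanishes_eventually _ (fun N => '[fourier g g N v, g j] - '[v, g j]) j.+1 _)) => /=.
    by move=> k; ring.
  move=> k jk; apply/eqP; rewrite subr_eq0; apply/eqP.
  rewrite dot_suml (bigD1_seq j) ?iota_uniq ?mem_index_iota //= dotZl.
  by rewrite (ortho01_coef _ _ ong) big1 ?addr0 // => i ij; rewrite dotZl ong.1 ?mulr0.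
have Qc v k : '[v - Q v, g k] = 0 by rewrite dotBl Qcoef subrr.
exists Q; split => //; split; first by case: QQ'.
move=> u v; rewrite -[v in LHS](subrK (Q v)) dotDr (Qort _ (v - Q v)) // add0r.
by rewrite -[u in RHS](subrK (Q u)) dotDl -[X in _ = X + _]dotC (Qort _ (u - Q u)) // rmorph0 add0r.
Qed.

Lemma linear_closed0 H (P : H -> Prop) :
  (forall c u v, P u -> P v -> P (c *: u + v)) -> forall u, P u -> P 0.
Proof. by move=> hP u /[dup] pu /(hP (-1) u u pu); rewrite scaleN1r addNr. Qed.

(** The two inclusions between closed spans are stated without coefficients: the
    vectors [g k] belong to every linearly closed predicate that holds on [x],
    and the orthogonal complement of [g] is contained in that of [x]. *)
Lemma orthonormalize H (x : nat -> H) : exists g : nat -> H,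
  [/\ ortho01 g,
      forall P : H -> Prop, (forall c u v, P u -> P v -> P (c *: u + v)) ->
        (forall k, P (x k)) -> forall k, P (g k) &
      forall v, (forall k, '[v, g k] = 0) -> forall k, '[v, x k] = 0].
Proof.
have [||| y [yo yx]] := @gram_schmidt _ H (hdot H) _ _ _ x.
- by move=> c u v w; rewrite dotDl dotZl.
- by move=> u v h; rewrite -dotC h rmorph0.
- by move=> u /eqP; rewrite dot_eq0 => /eqP.
pose g k := (sqrtC '[y k, y k])^-1 *: y k.
have g0 k : (g k == 0) = (y k == 0).
  by rewrite scaler_eq0 invr_eq0 sqrtC_eq0 dot_eq0 orbb.
exists g; split.
- split; first by move=> i j ij; rewrite dotZl dotZr (yo _ _ ij) !mulr0.
  move=> i; rewrite g0; have [y0|y0] := eqVneq (y i) 0.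
    by rewrite /g y0 scaler0 dot0l.
  rewrite dotZZ normfV ger0_norm ?sqrtC_ge0 ?dot_ge0 // exprVn sqrtCK mulVf //.
  by rewrite dot_eq0.
- move=> P hP Px k; have P0 := linear_closed0 hP (Px 0).
  suff Py j : P (y j) by have := hP (sqrtC '[y k, y k])^-1 (y k) 0 (Py k) P0; rewrite addr0.
  elim/ltn_ind: j => j IH; have [c /eqP] := yx j.
  rewrite -subr_eq => /eqP <-; rewrite addrC -scaleN1r.
  apply: (hP) => //.
  by elim/big_rec: _ => // i v _ Pv; apply: hP => //; apply: IH.
- move=> v hv k; have vy j : '[v, y j] = 0.
    have [->|y0] := eqVneq (y j) 0; first by rewrite dot0r.
    have := hv j; rewrite dotZr => /eqP; rewrite mulf_eq0 conjC_eq0 invr_eq0.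
    by rewrite sqrtC_eq0 dot_eq0 (negbTE y0) => /eqP.
  have [c ->] := yx k.
  rewrite dotDr vy add0r dot_sumr big1 // => i _.
  by rewrite dotZr vy mulr0.
Qed.

(** Removing the padding: the indices of nonzero vectors form an infinite set
    of natural numbers, which is in bijection with [nat]. *)
Lemma orthonormal_enum H (g : nat -> H) : ortho01 g ->
  (forall N, exists2 k, (N <= k)%N & g k != 0) ->
  exists e : nat -> H, [/\ forall i j, '[e i, e j] = (i == j)%:R,
     forall k, exists j, e k = g j &
     forall v, (forall k, '[v, e k] = 0) -> forall k, '[v, g k] = 0].
Proof.
move=> ong inf.
pose J : set nat := [set k | g k != 0]%classic.
have infJ : ~ finite_set J.
  rewrite finite_setP => -[n]; rewrite card_eq_sym => /card_set_bijP[f [_ _ fs]].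
  have [k] := inf (\max_(i < n) f i).+1.
  move=> nk gk; have /= [i /= ilt ik] := fs k gk.
  by move: nk; rewrite -ik ltnNge (leq_bigmax (Ordinal ilt)).
have /card_esym/card_set_bijP[f [fm fi fs]] := eq_card_nat (countableP J) infJ.
exists (g \o f); split.
- move=> i j /=; have [->|ij] := eqVneq i j.
    by rewrite ong.2 (fm j I).
  by rewrite ong.1 //; apply: contra ij => /eqP/fi ->; rewrite ?inE.
- by move=> k; exists (f k).
- move=> v hv k; have [->|gk] := eqVneq (g k) 0; first by rewrite dot0r.
  by have [i _ <-] := fs k gk; apply: hv.
Qed.

(** If [v] is orthogonal to [d], then [v - d] is at least as long as [v] by
    Pythagoras, so that [d] cannot lie in the ball of radius [|v|] around
    [v]. *)
Lemma dense_total H (D : set H) : dense D ->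
  forall v, (forall d, D d -> '[v, d] = 0) -> v = 0.
Proof.
move=> dD v hv; apply/eqP/negPn/negP => v0.
have nv : 0 < `|v| by rewrite normr_gt0.
have [] := dD (interior (ball v `|v|)).
- by exists v; apply: nbhsx_ballx.
- exact: open_interior.
move=> d [/interior_subset]; rewrite -ball_normE /= => hd Dd.
have : '[v, v] <= '[v - d, v - d].
  have hd' : '[d, v] = 0 by rewrite -dotC hv // rmorph0.
  rewrite dotBl !dotBr (hv d Dd) hd'.
  by rewrite sub0r opprK subr0 lerDl dot_ge0.
rewrite -!norm_sqr ler_pXn2r ?nnegrE // => /le_lt_trans /(_ hd).
by rewrite ltxx.
Qed.

Lemma separable_total H : separable H -> exists x : nat -> H, total_family x.
Proof.
move=> [D /countable_injP[f fi] dD].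
exists (fun k => xget 0 [set v | D v /\ f v = k]%classic) => v hv.
apply: (dense_total dD) => d Dd; have := hv (f d).
have h : exists y, [set w | D w /\ f w = f d]%classic y by exists d.
have [Dw fw] := xgetPex 0 h.
by rewrite (fi _ _ _ _ fw) ?inE.
Qed.

Lemma separable_has_onb H : separable H -> has_onb H.
Proof.
move=> /separable_total[x tx]; have [g [ong _ gx]] := orthonormalize x.
by exists g; split => // v hv; apply: tx; apply: gx.
Qed.

(** The constant [M] in [bounded_op] may be any complex number when the space is
    trivial, hence its replacement by [|M| ^ 2]. *)
Lemma bounded_opP H (A : H -> H) : bounded_op H A <-> linear A /\ bounded_map A.
Proof.
split=> -[lA [M hM]]; split=> //.
  exists (`|M| ^+ 2); split; first by rewrite exprn_ge0.
  move=> v; have h : 0 <= M * `|v| := le_trans (normr_ge0 _) (hM v).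
  rewrite -!norm_sqr -exprMn -[`|v| in leRHS]normr_id -normrM.
  by rewrite (ger0_norm h) ler_pXn2r ?nnegrE.
case: hM => M0 hM; exists (sqrtC M) => v.
have s0 : 0 <= sqrtC M by rewrite sqrtC_ge0.
rewrite -(@ler_pXn2r _ 2) ?nnegrE ?mulr_ge0 //.
by rewrite exprMn sqrtCK !norm_sqr.
Qed.

Lemma adjoint_bounded_op H (A B : H -> H) : adjoint A B -> bounded_op H A.
Proof. by move=> h; apply/bounded_opP; split; [apply: adjoint_linear h|case: h]. Qed.

Lemma adjE H (A B : H -> H) : adjoint A B -> adj A = B.
Proof.
move=> h.
have [b1 b2] : (bounded_op H (adj A) /\ forall u v, '[A u, v] = '[u, adj A v]).
  apply: (@xgetPex _ _ [set y | bounded_op H y /\ forall u v, '[A u, v] = '[u, y v]]%classic).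
  by exists B; split; [apply: adjoint_bounded_op (adjoint_sym h)|apply: h.2].
apply/funext => v; apply: dot_inj => u.
by rewrite -dotC -b2 h.2 dotC.
Qed.

Lemma adjoint_adj H (A : H -> H) : has_onb H -> bounded_op H A -> adjoint A (adj A).
Proof.
move=> obH /bounded_opP[lA bA].
by have [B hB] := adjoint_exists obH lA bA; rewrite (adjE hB).
Qed.

(** An orthonormal basis of [l2] is sent to the sequence [e]; infinite dimension
    of [l2] ensures that this basis is indexed by all of [nat]. *)
Lemma isometry_onto (l2 : hilbert R) H (e : nat -> H) :
  separable l2 -> infinite_dimensional l2 -> has_onb H ->
  (forall i j, '[e i, e j] = (i == j)%:R) ->
  exists U : l2 -> H, exists U' : H -> l2, [/\ adjoint U U',
    forall v, U' (U v) = v, forall k, U (U' (e k)) = e k &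
    forall v, (forall k, '[v, e k] = 0) -> U' v = 0].
Proof.
move=> sep infd obH one.
have [x tx] := separable_total sep.
have [g [ong _ gx]] := orthonormalize x.
have tg : total_family g by move=> v hv; apply: tx; apply: gx.
have infg N : exists2 k, (N <= k)%N & g k != 0.
  apply: contrapT => /forall2NP hN; apply: infd.
  exists (mkseq g N) => v; rewrite size_mkseq.
  exists (fun i => '[v, g i]).
  apply/eqP; rewrite -subr_eq0; apply/eqP; apply: tg => k.
  have [Nk|kN] := leqP N k.
    by case: (hN k) => // /negP; rewrite negbK => /eqP ->; rewrite dot0r.
  rewrite dotBl dot_suml (bigD1 (Ordinal kN)) //= nth_mkseq // dotZl.
  rewrite (ortho01_coef _ _ ong) big1 ?addr0 ?subrr // => i ik.
  by rewrite nth_mkseq // dotZl ong.1 ?mulr0.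
have [h [oh hg hv]] := orthonormal_enum ong infg.
have th : total_family h by move=> v vh; apply: tg; apply: hv.
have on0E (K : hilbert R) (a : nat -> K) : (forall i j, '[a i, a j] = (i == j)%:R) -> ortho01 a.
  move=> oa; split; first by move=> i j /negbTE ij; rewrite oa ij.
  move=> i; rewrite oa eqxx; case: eqVneq => // a0.
  by have := oa i i; rewrite a0 dot0l eqxx.
have onh := on0E _ _ oh; have one0 := on0E _ _ one.
have bes : bessel_family e 1 := ortho01_bessel one0.
have h0 k : h k = 0 -> e k = 0.
  move=> hk; have := oh k k; rewrite hk dot0l eqxx => /eqP.
  by rewrite eq_sym oner_eq0.
have [U [[U' UU'] Uh _ _]] := bessel_extension (ex_intro _ _ (conj onh th)) onh bes h0.
have U'U v : U' (U v) = v.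
  suff E : U' \o U = id by rewrite -[LHS]/((U' \o U) v) E.
  apply: (eq_on_total th (adjoint_comp UU' (adjoint_sym UU')).2 (adjoint_id l2).2).
  move=> i; apply/eqP; rewrite -subr_eq0; apply/eqP; apply: th => j.
  by rewrite dotBl /= (adjoint_sym UU').2 !Uh oh one subrr.
exists U, U'; split => //.
  by move=> k; rewrite -Uh U'U.
move=> v hv'; apply: th => k.
by rewrite (adjoint_sym UU').2 Uh.
Qed.

Definition onb H (W : eqType) (E : W -> H) :=
  (forall u v, '[E u, E v] = (u == v)%:R) /\ total_family E.

(** Enumerating the index type by [pickle] leaves gaps, which are filled with
    zeros. *)
Lemma onb_seq H (W : countType) (E : W -> H) : onb E ->
  exists f : nat -> H, [/\ ortho01 f, total_family f, forall w, f (pickle w) = E w &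
    forall k, f k = 0 \/ exists w : W, k = pickle w].
Proof.
move=> [oE tE].
pose f k := oapp E 0 (@pickle_inv W k).
have fE w : f (pickle w) = E w by rewrite /f pickleK_inv.
have fk k : (@pickle_inv W k = None /\ f k = 0) \/ exists w : W, k = pickle w.
  rewrite /f; have := @pickle_invK W k; case: (@pickle_inv W k) => [w /= <-|]; last by left.
  by right; exists w.
exists f; split => //.
- split.
    move=> i j ij; case: (fk i) => [[_ ->]|[u iu]]; first by rewrite dot0l.
    case: (fk j) => [[_ ->]|[v jv]]; first by rewrite dot0r.
    rewrite iu jv !fE oE; case: eqVneq => // uv.
    by rewrite iu jv uv eqxx in ij.
  move=> i; case: (fk i) => [[_ ->]|[u ->]]; first by rewrite dot0l eqxx.
  rewrite fE oE eqxx; case: eqVneq => // E0.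
  by have := oE u u; rewrite E0 dot0l eqxx.
- by move=> v hv; apply: tE => w; rewrite -fE.
- by move=> k; case: (fk k) => [[_ ->]|]; [left|right].
Qed.

Lemma onb_has_onb H (W : countType) (E : W -> H) : onb E -> has_onb H.
Proof. by move=> /onb_seq[f [? ? _ _]]; exists f. Qed.

(** Unlike a general Bessel family, an orthogonal family only needs uniformly
    bounded norms to be the image of an orthonormal basis. *)
Lemma ortho_extension H K (W : countType) (E : W -> H) (g : W -> K) (B : C) : onb E ->
  0 <= B -> ortho_family g -> (forall w, '[g w, g w] <= B) ->
  exists A : H -> K, exists2 A', adjoint A A' & forall w, A (E w) = g w.
Proof.
move=> oE B0 og hg.
have [f [onf tf fE f0]] := onb_seq oE.
pose g' k := oapp g 0 (@pickle_inv W k).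
have g'E w : g' (pickle w) = g w by rewrite /g' pickleK_inv.
have g'0 k : f k = 0 -> g' k = 0.
  rewrite /g'; have := @pickle_invK W k; case: (@pickle_inv W k) => //= w <-.
  rewrite fE => E0; have := oE.1 w w; rewrite E0 dot0l eqxx => /eqP.
  by rewrite eq_sym oner_eq0.
have bes : bessel_family g' B.
  apply: bessel_family_ortho => //.
    move=> i j ij; case: (f0 i) => [/g'0 ->|[u iu]]; first by rewrite dot0l.
    case: (f0 j) => [/g'0 ->|[v jv]]; first by rewrite dot0r.
    rewrite iu jv !g'E og //; apply: contra ij => /eqP uv.
    by rewrite iu jv uv.
  by move=> k; case: (f0 k) => [/g'0 ->|[u ->]]; rewrite ?dot0l ?g'E.
have [A [[A' hA] Af _ _]] := bessel_extension (onb_has_onb oE) onf bes g'0.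
by exists A, A' => // w; rewrite -fE Af g'E.
Qed.

End Bases.

(** * Operators bounded below *)

Section ClosedRange.
Variables (R : realType).
Local Notation C := R[i].
Implicit Types (H K L : hilbert R).

(** Gram-Schmidt applied to the image under [T] of a basis yields vectors of
    the form [g k = T (xi k)]. The lower bound turns [xi] into a Bessel family,
    so [g k |-> xi k] extends to a bounded operator [L] that vanishes on the
    orthogonal complement of the range of [T]. Then [T L] is the projection
    [Q] onto the closed span of [g], which is the range of [T]. *)
Lemma closed_range K H (T : K -> H) T' (d : C) :
  has_onb K -> has_onb H -> adjoint T T' -> 0 < d ->
  (forall x, d * '[x, x] <= '[T x, T x]) ->
  exists Q : H -> H, exists L : H -> K, exists2 L', adjoint L L' &
    [/\ adjoint Q Q, forall v, T (L v) = Q v, forall x, L (T x) = x &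
        forall x, Q (T x) = T x].
Proof.
move=> [f [onf tf]] obH hT d0 low; have lT := adjoint_linear hT.
have [g [ong gP gT]] := orthonormalize (fun k => T (f k)).
have Tinj x : T x = 0 -> x = 0.
  move=> Tx; apply/eqP; rewrite -dot_eq0 eq_le dot_ge0 andbT.
  by rewrite -(ler_pM2l d0) mulr0; have := low x; rewrite Tx dot0l.
have /choice[xi xiE] : forall k, exists x, g k = T x.
  move=> k; apply: (gP (fun v => exists x, v = T x)).
    by move=> c u v [x ->] [y ->]; exists (c *: x + y); rewrite lT.
  by move=> j; exists (f j).
have gker v : (forall k, '[v, g k] = 0) -> T' v = 0.
  by move=> /gT h; apply: tf => k; rewrite (adjoint_sym hT).2 h.
have bes : bessel_family xi d^-1.
  split; first by rewrite invr_ge0 ltW.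
  move=> c m N; rewrite mulrC ler_pdivlMr // mulrC.
  apply: le_trans (low _) _; rewrite lin_sum //.
  rewrite (eq_bigr (fun k => c k *: g k)) => [|i _]; last by rewrite linZ // xiE.
  by have := (ortho01_bessel ong).2 c m N; rewrite mul1r.
have xi0 k : g k = 0 -> xi k = 0 by rewrite xiE => /Tinj.
have [L [[L' hL] Lg L0 _]] := bessel_extension obH ong bes xi0.
have [Q [hQ Qg Q0 Qc]] := projection_exists obH ong.
have TL v : T (L v) = Q v.
  (* The vectors [g k] span the range of [Q] and the vectors [v - Q v] its
     orthogonal complement. *)
  pose fam (i : nat + H) := match i with inl k => g k | inr v => v - Q v end.
  have tfam : total_family fam.
    move=> x hx; have hg k : '[x, g k] = 0 by apply: (hx (inl k)).
    have := hx (inr x); rewrite /= (Q0 x hg) subr0 => /eqP.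
    by rewrite dot_eq0 => /eqP.
  suff E : T \o L = Q by rewrite -E.
  apply: (eq_on_total tfam (adjoint_comp hL hT).2 hQ.2) => -[k|x] /=.
    by rewrite Lg Qg xiE.
  have h k : '[x - Q x, g k] = 0 by rewrite dotBl Qc subrr.
  by rewrite L0 // Q0 // lin0.
have QT x : Q (T x) = T x.
  apply/eqP; rewrite eq_sym -subr_eq0 -dot_eq0.
  have h k : '[T x - Q (T x), g k] = 0 by rewrite dotBl Qc subrr.
  rewrite dotBr -[X in _ - X]hQ.2 (Q0 _ h) dot0l subr0.
  by rewrite -(adjoint_sym hT).2 (gker _ h) dot0l.
exists Q, L, L' => //; split => //.
by move=> x; apply/eqP; rewrite -subr_eq0; apply/eqP/Tinj; rewrite linB // TL QT subrr.
Qed.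

(** The space at hand is the range of [1 - Q]. If Gram-Schmidt on the images of
    a basis gave at most [N] nonzero vectors there, then some nontrivial
    combination of [z 0, ..., z N] would be killed by [1 - Q]. *)
Lemma kernel_basis H (Q : H -> H) (z : nat -> H) :
  has_onb H -> adjoint Q Q -> (forall v, Q (Q v) = Q v) ->
  (forall i j, '[z i, z j] = (i == j)%:R) ->
  (forall N (a : nat -> C), let x := \sum_(i < N) a i *: z i in Q x = x -> x = 0) ->
  exists e : nat -> H, [/\ forall i j, '[e i, e j] = (i == j)%:R,
    forall k, Q (e k) = 0 &
    forall v, (forall k, '[v, e k] = 0) -> Q v = v].
Proof.
move=> [f [onf tf]] hQ Q_idem oz inj; have lQ := adjoint_linear hQ.
have [g [ong gP gT]] := orthonormalize (fun k => f k - Q (f k)).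
have Qg k : Q (g k) = 0.
  apply: (gP (fun v => Q v = 0)).
    by move=> c u v Qu Qv; rewrite lQ Qu Qv scaler0 addr0.
  by move=> j; rewrite linB // Q_idem subrr.
have gQ v : (forall k, '[v, g k] = 0) -> Q v = v.
  move=> /gT h; apply/eqP; rewrite eq_sym -subr_eq0; apply/eqP; apply: tf => k.
  by have := h k; rewrite dotBr dotBl hQ.2.
have infg N : exists2 k, (N <= k)%N & g k != 0.
  apply: contrapT => /forall2NP hN.
  (* The matrix has more rows than columns: a row vector in its kernel gives the
     coefficients of the combination. *)
  pose A : 'M[C]_(N.+1, N) := \matrix_(i, j) '[z i - Q (z i), g j].
  have kA : kermx A != 0.
    rewrite kermx_eq0 /row_free; apply/negP => /eqP rA.
    by have := rank_leq_col A; rewrite rA ltnn.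
  have [al ai alA] : exists2 al : 'rV[C]_N.+1, al != 0 & al *m A = 0.
    have [i ai] : exists i, row i (kermx A) != 0.
      apply: contrapT => h; case/negP: kA; apply/eqP/row_matrixP => i.
      by rewrite row0; apply/eqP/negPn/negP => hi; apply: h; exists i.
    by exists (row i (kermx A)); rewrite // -row_mul mulmx_ker row0.
  pose a k := al 0 (inord k).
  pose x := \sum_(i < N.+1) a i *: z i.
  have Qx : Q x = x.
    suff /gQ : forall k, '[x - Q x, g k] = 0.
      rewrite linB // Q_idem subrr => /esym/eqP; by rewrite subr_eq0 => /eqP.
    move=> k; have [Nk|kN] := leqP N k.
      by case: (hN k) => // /negP; rewrite negbK => /eqP ->; rewrite dot0r.
    transitivity ((al *m A) 0 (Ordinal kN)); last by rewrite alA mxE.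
    rewrite mxE /x lin_sum // -sumrB dot_suml; apply: eq_bigr => j _.
    by rewrite linZ // -scalerBr dotZl /a inord_val [A _ _]mxE.
  have x0 := inj _ _ Qx; rewrite -/x in x0.
  case/negP: ai; apply/eqP/matrixP => i0 j; rewrite ord1 mxE.
  have : '[x, z j] = 0 by rewrite x0 dot0l.
  rewrite dot_suml (bigD1 j) //= dotZl oz eqxx mulr1 /a inord_val big1 ?addr0 // => k kj.
  by rewrite dotZl oz (_ : (k == j :> nat) = false) ?mulr0 //; apply/negbTE.
have [e [oe eg ev]] := orthonormal_enum ong infg.
exists e; split => //.
- by move=> k; have [j ->] := eg k.
- by move=> v /ev /gQ.
Qed.

End ClosedRange.

(** * The intertwiner between the deformed and the free generators *)

Section Words.
Variables (R : realType) (n : nat).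
Local Notation C := R[i].
Implicit Types (H K L : hilbert R) (i j : 'I_n) (w : seq 'I_n).

(** The ratio of the norm of the tensor [e_i (x) e_w] to that of [e_w], where
    [s ^ 2] is the deformation parameter. *)
Definition kappa (s : C) w : C := if w is [::] then 1 else s.

(** The matrix of [l (e_i) + l (e_i)^*] in the normalized basis of words, for
    the deformation parameter [s ^ 2]. *)
Definition semicircular (s : C) H (E : seq 'I_n -> H) (S : 'I_n -> H -> H) :=
  [/\ forall i, adjoint (S i) (S i), forall i, S i (E [::]) = E [:: i] &
      forall i j w, S i (E (j :: w)) =
        s *: E [:: i, j & w] + ((i == j)%:R * kappa s w) *: E w].

(** The injectivity of [phi] makes the [n]-term sums attached to distinct words
    orthogonal. The two uses are appending and prepending a doubled letter. *)
Lemma doubling_isometry K H (E1 : seq 'I_n -> K) (E : seq 'I_n -> H)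
    (phi : 'I_n -> seq 'I_n -> seq 'I_n) :
  onb E1 -> onb E ->
  (forall i j u v, (phi i u == phi j v) = (u == v) && (i == j)) ->
  exists M : K -> H, exists2 M', adjoint M M' &
    (forall w, M (E1 w) = \sum_i E (phi i w)) /\
    (forall x y, '[M x, M y] = n%:R * '[x, y]).
Proof.
move=> oE1 oE iphi.
pose g w := \sum_i E (phi i w).
have gg u v : '[g u, g v] = (u == v)%:R * n%:R.
  rewrite dot_suml.
  rewrite (eq_bigr (fun=> (u == v)%:R)) => [|i _].
    by rewrite sumr_const card_ord mulr_natr.
  rewrite dot_sumr (bigD1 i) //= oE.1 iphi eqxx andbT big1 ?addr0 // => j ji.
  by rewrite oE.1 iphi [i == j]eq_sym (negbTE ji) andbF.
have og : ortho_family g by move=> u v /negbTE uv; rewrite gg uv mul0r.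
have gn w : '[g w, g w] <= n%:R by rewrite gg eqxx mul1r.
have [M [M' hM ME]] := ortho_extension oE1 (ler0n _ n) og gn.
exists M, M' => //; split => // x y.
rewrite hM.2 -[n%:R]conjCK -dotZr.
have hn := adjointZ n%:R (adjoint_id K).
suff -> : M' (M y) = (Num.conj n%:R) *: y by [].
have -> : (Num.conj n%:R : C) = n%:R by rewrite conjC_nat.
suff E2 : M' \o M = (fun v => n%:R *: v) by rewrite -[LHS]/((M' \o M) y) E2.
apply: (eq_on_total oE1.2 (adjoint_comp hM (adjoint_sym hM)).2 hn.2) => w /=.
apply/eqP; rewrite -subr_eq0; apply/eqP; apply: oE1.2 => v.
by rewrite dotBl (adjoint_sym hM).2 !ME gg dotZl oE1.1 mulrC subrr.
Qed.

(** Appending a doubled letter commutes with the creation of a letter on the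
    left and with the annihilation of the first letter of a nonempty word. On
    the empty word the letter annihilated is one of the appended ones, which
    produces [c s E [:: j]]; the defect of [kappa] compensates it exactly when
    [1 + c s = s ^ 2]. For the lower bound, [T] is written as a diagonal operator
    plus [c M]; the diagonal operator differs from [s] times the isometry [J]
    at the vacuum only, which is orthogonal to the range of [M]. *)
Lemma intertwiner K H (E1 : seq 'I_n -> K) (E : seq 'I_n -> H) S1 S (s : C) :
  0 < s -> onb E1 -> onb E -> semicircular 1 E1 S1 -> semicircular s E S ->
  let c := s - s^-1 in
  exists T : K -> H, exists M : K -> H, exists T', exists2 M',
    adjoint T T' /\ adjoint M M' &
    [/\ forall w, T (E1 w) = kappa s w *: E w + c *: M (E1 w),
        forall w, M (E1 w) = \sum_i E (w ++ [:: i; i]),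
        forall i x, S i (T x) = s *: T (S1 i x),
        forall x, '[M x, M x] = n%:R * '[x, x] &
        forall x, (`|c| * n%:R - s * sqrtC n%:R) * '[x, x] <= `|'[T x, M x]| ].
Proof.
move=> s0 oE1 oE [hS1 S10 S1c] [hS S0 Sc] c.
have cR : c \is Num.real by rewrite rpredB ?rpredV ?gtr0_real.
have s0' : s != 0 by rewrite gt_eqF.
have iphi i j u v : ((fun i w => w ++ [:: i; i]) i u == (fun i w => w ++ [:: i; i]) j v) = (u == v) && (i == j).
  rewrite /= -!cat_rcons !cats0 !eqseq_rcons.
  by case: (i == j); rewrite ?andbT ?andbF.
have [M [M' hM [ME MM]]] := doubling_isometry oE1 oE iphi.
have dE (a b : C) u v : '[a *: E u, b *: E v] = a * Num.conj b * (u == v)%:R.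
  by rewrite dotZl dotZr oE.1 mulrA.
pose B : C := 1 + s ^+ 2.
have B0 : 0 <= B by rewrite addr_ge0 // exprn_ge0 // ltW.
have og : ortho_family (fun w => kappa s w *: E w).
  by move=> u v /negbTE uv; rewrite dE uv mulr0.
have gB w : '[kappa s w *: E w, kappa s w *: E w] <= B.
  rewrite dE eqxx mulr1 -normCK; case: w => [|j w] /=.
    by rewrite normr1 expr1n lerDl exprn_ge0 // ltW.
  by rewrite (ger0_norm (ltW s0)) /B lerDr.
have [A [A' hA AE]] := ortho_extension oE1 B0 og gB.
have og1 : ortho_family E by move=> u v /negbTE uv; rewrite oE.1 uv.
have gB1 w : '[E w, E w] <= 1 by rewrite oE.1 eqxx.
have [J [J' hJ JE]] := ortho_extension oE1 ler01 og1 gB1.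
have hT := adjointD hA (adjointZ c hM).
exists (fun v => A v + c *: M v), M, (fun v => A' v + Num.conj c *: M' v), M'.
  by split.
have JJ x : '[J x, J x] = '[x, x].
  rewrite hJ.2; suff E2 : J' \o J = id by rewrite -[X in '[_, X] = _]/((J' \o J) x) E2.
  apply: (eq_on_total oE1.2 (adjoint_comp hJ (adjoint_sym hJ)).2 (adjoint_id K).2) => w /=.
  apply/eqP; rewrite -subr_eq0; apply/eqP; apply: oE1.2 => v.
  by rewrite dotBl (adjoint_sym hJ).2 !JE oE.1 oE1.1 subrr.
have A'M y : A' (M y) = s *: J' (M y).
  have hJM := adjointZ s (adjoint_comp hM (adjoint_sym hJ)).
  suff E2 : A' \o M = (fun v => s *: (J' \o M) v) by rewrite -[LHS]/((A' \o M) y) E2.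
  apply: (eq_on_total oE1.2 (adjoint_comp hM (adjoint_sym hA)).2 hJM.2) => v /=.
  apply/eqP; rewrite -subr_eq0; apply/eqP; apply: oE1.2 => u.
  rewrite dotBl dotZl (adjoint_sym hA).2 (adjoint_sym hJ).2 AE JE dotZr ME dot_suml.
  apply/eqP; rewrite subr_eq0; apply/eqP.
  case: u => [|k u] /=; last by rewrite geC0_conj // ltW.
  by rewrite big1 ?mulr0 // => i _; rewrite oE.1; case: v.
have AM x : '[A x, M x] = s * '[J x, M x].
  by rewrite hA.2 A'M dotZr geC0_conj ?(ltW s0) // hJ.2.
have kE (i : 'I_n) w : kappa s (w ++ [:: i; i]) = s by case: w.
have k1 w : kappa 1 w = 1 by case: w.
have sumd (j : 'I_n) (a : C) (f : 'I_n -> H) : \sum_i ((j == i)%:R * a) *: f i = a *: f j.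
  rewrite (bigD1 j) //= eqxx mul1r big1 ?addr0 // => i /negbTE ij.
  by rewrite eq_sym ij mul0r scale0r.
split.
- by move=> w; rewrite AE.
- exact: ME.
- move=> j x.
  have hL := adjoint_comp hT (hS j).
  have hR := adjointZ s (adjoint_comp (hS1 j) hT).
  suff E2 : S j \o (fun v => A v + c *: M v) = (fun x => s *: ((fun v => A v + c *: M v) \o S1 j) x).
    by rewrite -[LHS]/((S j \o (fun v => A v + c *: M v)) x) E2.
  have lS := adjoint_linear (hS j); have lA := adjoint_linear hA; have lM := adjoint_linear hM.
  apply: (eq_on_total oE1.2 hL.2 hR.2) => -[|k w] /=.
    rewrite AE ME S10 AE ME /= scale1r linD // S0 linZ // lin_sum //.
    rewrite (eq_bigr _ (fun i _ => Sc j i [:: i])) /=.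
    rewrite big_split /= sumd -scaler_sumr !scalerDr !scalerA addrCA.
    rewrite [RHS]addrC [s * c]mulrC; congr (_ + _).
    by rewrite -[X in X + _]scale1r -scalerDl; congr (_ *: _); rewrite /c; field.
  rewrite AE ME S1c k1 mulr1 scale1r /= (linD lS) !(linZ lS) Sc (lin_sum _ _ _ lS).
  rewrite (linD lA) (linD lM) (linZ lA) (linZ lM) !AE !ME /=.
  rewrite (eq_bigr _ (fun i _ => Sc j k (w ++ [:: i; i]))) /=.
  under eq_bigr do rewrite kE.
  rewrite big_split /= -!scaler_sumr !scalerDr !scalerA.
  by congr (_ + _ *: _ + (_ *: _ + _ *: _)); ring.
- by move=> x; rewrite MM.
- move=> x.
  rewrite dotDl AM dotZl MM.
  have h0 : s * sqrtC n%:R * '[x, x] = `|s * sqrtC n%:R * '[x, x]|.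
    by rewrite ger0_norm // !mulr_ge0 ?dot_ge0 ?sqrtC_ge0 ?ler0n // ltW.
  have h1 : `|s * '[J x, M x]| <= s * sqrtC n%:R * '[x, x].
    rewrite normrM (ger0_norm (ltW s0)) -mulrA ler_pM2l //.
    have p0 : 0 <= sqrtC n%:R * '[x, x] by rewrite mulr_ge0 ?dot_ge0 ?sqrtC_ge0 ?ler0n.
    rewrite -(@ler_pXn2r _ 2) ?nnegrE //; apply: le_trans (cauchy_schwarz _ _) _.
    by rewrite JJ MM exprMn sqrtCK expr2 mulrCA.
  have h2 : `|c * (n%:R * '[x, x])| = `|c| * n%:R * '[x, x].
    by rewrite !normrM normr_nat (ger0_norm (dot_ge0 x)) mulrA.
  rewrite mulrBl -h2 lerBlDl; apply: le_trans (lerD h1 (lexx _)).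
  rewrite -[X in `|X| <= _](addKr (s * '[J x, M x])) addrC -[X in _ <= X + _]normrN.
  by rewrite [X in _ <= X]addrC; exact: ler_normD.
Qed.

End Words.

(** * Simplicity of the eigenvalue *)

Section Recurrence.
Variable (R : realType).
Local Notation C := R[i].

(** Bernoulli's inequality makes [r ^ k] unbounded. *)
Lemma bounded_geometric (r a B : C) : 1 < r -> 0 <= a ->
  (forall k, r ^+ k * a <= B) -> a = 0.
Proof.
move=> r1 a0 hB; apply/eqP; apply: contraT => an0.
have ap : 0 < a by rewrite lt_def an0.
have B0 : 0 <= B by have := hB 0%N; rewrite expr0 mul1r; apply: le_trans.
have bern k : 1 + k%:R * (r - 1) <= r ^+ k.
  elim: k => [|k IH]; first by rewrite mul0r addr0.
  have d0 : 0 <= r - 1 by rewrite subr_ge0 ltW.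
  have -> : r ^+ k.+1 = r ^+ k + r ^+ k * (r - 1) by rewrite exprSr; ring.
  rewrite -[k.+1]addn1 natrD mulrDl mul1r addrA lerD //.
  by rewrite -[X in X <= _]mul1r ler_wpM2r // exprn_ege1 // ltW.
pose X := B / a / (r - 1).
have d0 : 0 < r - 1 by rewrite subr_gt0.
have X0 : 0 <= X by rewrite !divr_ge0 // ltW.
have XE : X = (complex.Re X)%:C by rewrite RRe_real // ger0_real.
have X0' : 0 <= complex.Re X by rewrite -lecR -XE.
have := archi_boundP X0'; set k := Num.bound _ => hk.
have : X < k%:R by rewrite XE -(rmorph_nat (real_complex R)) ltcR.
rewrite /X ltr_pdivrMr // ltr_pdivrMr // => h.
have : r ^+ k * a <= (k%:R * (r - 1)) * a by apply: le_trans (hB k) (ltW h).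
rewrite ler_pM2r // => h2; have := le_trans (bern k) h2.
by rewrite gerDr => /le_lt_trans /(_ ltr01); rewrite ltxx.
Qed.

(** The combination [f (k + 1) - be f k] is a geometric sequence of ratio [al].
    As [|al| ^ 2 > n], it can obey the bound only if it vanishes. *)
Lemma decaying_solution (f : nat -> C) (al be B : C) (n : nat) :
  (0 < n)%N -> al * be = n%:R -> n%:R < `|al| ^+ 2 ->
  (forall k, f k.+2 + n%:R * f k = (al + be) * f k.+1) ->
  (forall k, `|f k| ^+ 2 <= B * n%:R ^+ k) ->
  forall k, f k.+1 = be * f k.
Proof.
move=> n0 ab nal rec bf.
pose h k := f k.+1 - be * f k.
have hS k : h k.+1 = al * h k.
  have := rec k; rewrite /h -ab => e.
  have -> : f k.+2 = (al + be) * f k.+1 - al * be * f k by rewrite -e; ring.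
  by ring.
have hk k : h k = al ^+ k * h 0%N.
  by elim: k => [|k IH]; rewrite ?mul1r // hS IH exprS mulrA.
have np : 0 < (n%:R : C) by rewrite ltr0n.
pose D := 2 * (B * n%:R + `|be| ^+ 2 * B).
have hD k : `|h k| ^+ 2 <= D * n%:R ^+ k.
  have h2 : `|h k| ^+ 2 <= 2 * (`|f k.+1| ^+ 2 + `|be * f k| ^+ 2).
    have h3 : `|h k| <= `|f k.+1| + `|be * f k| := ler_normB _ _.
    apply: le_trans (_ : (`|f k.+1| + `|be * f k|) ^+ 2 <= _).
      by rewrite ler_pXn2r ?nnegrE ?addr_ge0.
    rewrite -subr_ge0; set x := `|_|; set y := `|_|.
    have -> : 2 * (x ^+ 2 + y ^+ 2) - (x + y) ^+ 2 = (x - y) ^+ 2 by ring.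
    by rewrite real_exprn_even_ge0 // rpredB ?normr_real.
  apply: le_trans h2 _; rewrite /D -mulrA ler_wpM2l // mulrDl lerD //.
    by apply: le_trans (bf _) _; rewrite exprS mulrA.
  by rewrite normrM exprMn -[X in _ <= X]mulrA ler_wpM2l ?exprn_ge0.
have h0 : h 0%N = 0.
  apply/eqP; rewrite -normr_eq0 -sqrf_eq0; apply/eqP.
  apply: (@bounded_geometric (`|al| ^+ 2 / n%:R) _ D).
  - by rewrite ltr_pdivlMr // mul1r.
  - by rewrite exprn_ge0.
  move=> k; have := hD k; rewrite hk normrM normrX exprMn exprAC => e.
  rewrite exprMn exprVn mulrAC ler_pdivrMr // exprn_gt0 //.
move=> k; have := hk k; rewrite h0 mulr0 /h => /eqP.
by rewrite subr_eq0 => /eqP.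
Qed.

End Recurrence.

Section Eigen.
Variables (R : realType) (n : nat).
Local Notation C := R[i].
Variables (H : hilbert R) (E : seq 'I_n -> H) (S : 'I_n -> H -> H) (s : C).
Hypothesis (n1 : (1 < n)%N) (s0 : 0 < s) (oE : onb E) (hS : semicircular s E S).
Hypothesis (cond : s ^+ 2 < sqrtC n%:R * `|1 - s ^+ 2|).

Definition square_sum (x : H) : H := \sum_i S i (S i x).

Lemma square_sum_adjoint : adjoint square_sum square_sum.
Proof.
have [hS1 _ _] := hS; apply: adjoint_sum => i.
exact: (adjoint_comp (hS1 i) (hS1 i)).
Qed.

Lemma square_sum_vacuum :
  square_sum (E [::]) = n%:R *: E [::] + s *: \sum_i E [:: i; i].
Proof.
have [_ S0 Sc] := hS.
rewrite /square_sum (eq_bigr (fun i => s *: E [:: i; i] + E [::])) => [|i _].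
  by rewrite big_split /= sumr_const card_ord addrC scaler_nat scaler_sumr.
by rewrite S0 Sc eqxx mul1r scale1r.
Qed.

Lemma square_sum_word j w : square_sum (E (j :: w)) =
  s ^+ 2 *: (\sum_i E [:: i, i, j & w]) + (n%:R * s ^+ 2) *: E (j :: w)
   + kappa s w *: S j (E w).
Proof.
have [hS1 S0 Sc] := hS; have lS i := adjoint_linear (hS1 i).
rewrite /square_sum (eq_bigr (fun i => s ^+ 2 *: E [:: i, i, j & w]
   + s ^+ 2 *: E (j :: w) + ((i == j)%:R * kappa s w) *: S i (E w))) => [|i _].
  rewrite !big_split /= scaler_sumr sumr_const card_ord -scaler_nat scalerA.
  congr (_ + _ + _).
  rewrite (bigD1 j) //= eqxx mul1r big1 ?addr0 // => i /negbTE ij.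
  by rewrite ij mul0r scale0r.
rewrite Sc (linD (lS i)) !(linZ (lS i)) Sc scalerDr !scalerA eqxx mul1r /=.
by rewrite -expr2.
Qed.

Let lam := n%:R + s ^+ 2 / (1 - s ^+ 2).

Lemma cond_neq0 : 1 - s ^+ 2 != 0.
Proof.
apply: contraTneq cond => ->; rewrite normr0 mulr0 lt_gtF //.
by rewrite exprn_gt0.
Qed.

(** Let [M] prepend a doubled letter. On the orbit [x, M x, M (M x), ...] of a
    vector orthogonal to the vacuum, [square_sum] is tridiagonal, so
    [decaying_solution] applies to the coefficients of [psi] and determines them
    from the first one. The first coefficient vanishes for [x] a single letter
    and for [x] orthogonal to the range of [M] in degree at least two, since
    there the initial condition of the recurrence is not the one of the
    decaying solution. Every word is a combination of such vectors and of
    [M (E w)] with [w] shorter. *)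
Lemma eigen_unique (psi : H) :
  '[E [::], psi] = 0 -> square_sum psi = lam *: psi -> psi = 0.
Proof.
move=> psi0 eig.
have [hS1 S0 Sc] := hS.
have iphi i j (u v : seq 'I_n) :
    ((fun i w => [:: i, i & w]) i u == (fun i w => [:: i, i & w]) j v) = (u == v) && (i == j).
  by rewrite /= !eqseq_cons; case: (i == j); rewrite ?andbT ?andbF.
have [M [M' hM [ME MM]]] := doubling_isometry oE oE iphi; rewrite /= in ME.
have lM := adjoint_linear hM.
have lN := adjoint_linear square_sum_adjoint.
pose t := s ^+ 2; have t0 : 0 < t by rewrite exprn_gt0.
have t0' : t != 0 by rewrite gt_eqF.
have t1 : 1 - t != 0 := cond_neq0.
have np : 0 < (n%:R : C) by rewrite ltr0n (ltn_trans _ n1).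
have lamR : Num.conj lam = lam.
  by rewrite conj_Creal // rpredD ?realn // rpredM ?rpredV ?rpredB ?rpredX // gtr0_real.
have Nlam x : '[square_sum x, psi] = lam * '[x, psi].
  by rewrite square_sum_adjoint.2 eig dotZr lamR.
have kapE w : s *: E w + (1 - s) *: ('[E w, E [::]] *: E [::]) = kappa s w *: E w.
  rewrite oE.1; case: w => [|k w] /=; last by rewrite scale0r scaler0 addr0.
  by rewrite !scale1r -scalerDl addrC subrK scale1r.
have NM y : square_sum (M y) = t *: M (M y) + (t * (n%:R + 1)) *: M y
    + (n%:R * s) *: (s *: y + (1 - s) *: ('[y, E [::]] *: E [::])).
  have hMM := adjointZ t (adjoint_comp hM hM).
  have hM1 := adjointZ (t * (n%:R + 1)) hM.
  have hP := adjointZ (n%:R * s) (adjointD (adjointZ s (adjoint_id H))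
    (adjointZ (1 - s) (adjoint_rank1 (E [::]) (E [::])))).
  have hR := adjointD (adjointD hMM hM1) hP.
  have hL := adjoint_comp hM square_sum_adjoint.
  suff E2 : square_sum \o M = (fun y => t *: M (M y) + (t * (n%:R + 1)) *: M y
    + (n%:R * s) *: (s *: y + (1 - s) *: ('[y, E [::]] *: E [::]))).
    by rewrite -[LHS]/((square_sum \o M) y) E2.
  apply: (eq_on_total oE.2 hL.2 hR.2) => w /=.
  rewrite kapE ME (lin_sum _ _ _ lN) (lin_sum _ _ _ lM).
  have F i : square_sum (E [:: i, i & w]) = t *: M (E [:: i, i & w])
     + (t * (n%:R + 1)) *: E [:: i, i & w] + (s * kappa s w) *: E w.
    rewrite square_sum_word /= Sc eqxx mul1r scalerDr !scalerA -expr2 -ME.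
    rewrite !addrA -/t; congr (_ + _); rewrite -addrA -scalerDl.
    by congr (_ + _ *: _); ring.
  rewrite (eq_bigr _ (fun i _ => F i)) !big_split /= -!scaler_sumr sumr_const card_ord.
  by rewrite -[E w *+ n]scaler_nat !scalerA; congr (_ + _ *: _); ring.
have [al [be [ab nal [lamE alE]]]] : exists al be : C, [/\ al * be = n%:R, n%:R < `|al| ^+ 2
     & al + be = (lam - t * (n%:R + 1)) / t /\ al = n%:R * (1 - t) / t].
  (* The roots of the characteristic polynomial of the recurrence below. *)
  exists (n%:R * (1 - t) / t), (t / (1 - t)); split.
  - by field; rewrite t0' t1.
  - rewrite !normrM normfV normr_nat (ger0_norm (ltW t0)) exprMn exprVn.
    rewrite ltr_pdivlMr ?exprn_gt0 // [X in _ < X]exprMn [X in _ < X * _]expr2 -mulrA ltr_pM2l //.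
    rewrite -[X in X * `|_| ^+ 2]sqrtCK -exprMn ltr_pXn2r ?nnegrE //.
    exact: ltW.
  - by split=> //; rewrite /lam -/t; field; rewrite t0' t1.
have MO y : '[M y, E [::]] = 0.
  rewrite hM.2 (_ : M' (E [::]) = 0) ?dot0r //.
  apply: oE.2 => w; rewrite (adjoint_sym hM).2 ME dot_sumr big1 // => i _.
  by rewrite oE.1.
pose f x k := '[iter k M x, psi].
have frec x k : '[iter k M x, E [::]] = 0 ->
   f x k.+2 + n%:R * f x k = (al + be) * f x k.+1.
  move=> hx; have := Nlam (M (iter k M x)).
  rewrite NM hx scale0r scaler0 addr0 scalerA !dotDl !dotZl -!/(f x _.+1).
  rewrite -/(f x k) -[iter k M x]/(iter k M x) lamE => e.
  apply: (mulfI t0').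
  have -> : t * ((lam - t * (n%:R + 1)) / t * f x k.+1) = (lam - t * (n%:R + 1)) * f x k.+1 by field.
  by rewrite mulrBl -e /t; ring.
have fB x k : `|f x k| ^+ 2 <= ('[x, x] * '[psi, psi]) * n%:R ^+ k.
  apply: le_trans (cauchy_schwarz _ _) _; rewrite mulrAC ler_wpM2r ?dot_ge0 //.
  rewrite le_eqVlt; apply/orP; left; apply/eqP.
  by elim: k => [|k IH]; rewrite ?mulr1 //= MM IH exprS; ring.
have fdec x : '[x, E [::]] = 0 -> forall k, f x k.+1 = be * f x k.
  move=> hx; apply: (decaying_solution _ ab nal _ (fB x)); first exact: ltnW.
  by move=> k; apply: frec; case: k => [|k] //; apply: MO.
have fzero x : '[x, E [::]] = 0 -> f x 0%N = 0 -> forall k, f x k = 0.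
  move=> hx f0; elim=> // k IH; by rewrite fdec // IH mulr0.
have words m : forall w, (size w <= m)%N -> forall k, f (E w) k = 0.
  elim: m => [|m IH] w.
    rewrite leqn0 size_eq0 => /eqP -> [|k]; first exact: psi0.
    have f1 : f (E [::]) 1%N = 0.
      have := Nlam (E [::]); rewrite square_sum_vacuum -ME dotDl !dotZl psi0 !mulr0 add0r.
      by move/eqP; rewrite mulf_eq0 gt_eqF //= => /eqP.
    rewrite /f iterSr; apply: fzero; [exact: MO|exact: f1].
  case: w => [|j [|k w]] hw.
  - exact: IH.
  - apply: fzero; first by rewrite oE.1.
    have h0 : '[E [:: j], E [::]] = 0 by rewrite oE.1.
    have := Nlam (E [:: j]).
    rewrite square_sum_word /= scale1r S0 -ME !dotDl !dotZl -/t -/(f (E [:: j]) 1%N) (fdec _ h0).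
    rewrite -/(f (E [:: j]) 0%N) => e.
    have : (n%:R - 1) * (1 - t) * f (E [:: j]) 0%N = 0.
      have -> : (n%:R - 1) * (1 - t) * f (E [:: j]) 0%N =
        (t * al + t - 1) * f (E [:: j]) 0%N by rewrite alE; field.
      have -> : t * al = lam - t * (n%:R + 1) - t * be.
        by rewrite -[al](addrK be) lamE; field.
      by rewrite -(subrr (lam * f (E [:: j]) 0%N)) -[X in _ = _ - X]e; ring.
    move/eqP; rewrite !mulf_eq0 (negbTE t1) orbF subr_eq0.
    by rewrite pnatr_eq1 gtn_eqF //= => /eqP.
  (* Removing from [E [:: j, k & w]] its component along the range of [M],
       which is [d] times [M (E w)] because [|M (E w)| ^ 2 = n]. *)
  - pose d : C := (j == k)%:R / n%:R.
    pose x := E [:: j, k & w] - d *: M (E w).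
    have h0 : '[x, E [::]] = 0 by rewrite dotBl dotZl MO oE.1 mulr0 subr0.
    have Nx : square_sum x = t *: M x + (t * (n%:R + 1)) *: x.
      rewrite /x (linB lN) (linZ lN) NM kapE square_sum_word Sc -ME /=.
      rewrite (linB lM) (linZ lM) !scalerDr !scalerN !scalerA -/t -expr2 -/t.
      have -> : d * (n%:R * s * kappa s w) = s * ((j == k)%:R * kappa s w).
        by rewrite /d; field; rewrite gt_eqF.
      have -> : (t * (n%:R + 1)) *: E [:: j, k & w] =
          (n%:R * t) *: E [:: j, k & w] + t *: E [:: j, k & w].
        by rewrite -scalerDl; congr (_ *: _); ring.
      rewrite [d * t]mulrC [d * (t * _)]mulrC addrA opprD addrACA subrr addr0.
      by rewrite -[X in X - _]addrA opprD addrACA.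
    have f0 : f x 0%N = 0.
      have := Nlam x; rewrite Nx dotDl !dotZl -/(f x 1%N) (fdec _ h0).
      rewrite -/(f x 0%N) => e.
      have : t * al * f x 0%N = 0.
        have -> : t * al = lam - t * (n%:R + 1) - t * be.
          by rewrite -[al](addrK be) lamE; field.
        by rewrite -(subrr (lam * f x 0%N)) -[X in _ = _ - X]e; ring.
      move/eqP; rewrite mulf_eq0 => /orP[|/eqP //].
      rewrite mulf_eq0 (negbTE t0') /= => /eqP al0.
      by move: nal; rewrite al0 normr0 expr0n /= lt_gtF.
    move=> m'; have fx := fzero x h0 f0 m'.
    have fw := IH w (leq_trans (leqnSn _) hw) m'.+1.
    have -> : E [:: j, k & w] = d *: M (E w) + x by rewrite addrC subrK.
    have il : linear (iter m' M).
      by elim: (m') => [|p ip] c u v //=; rewrite ip lM.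
    by rewrite /f il dotDl dotZl -iterSr -/(f (E w) m'.+1) -/(f x m') fx fw mulr0 addr0.
apply: oE.2 => w; rewrite -dotC.
by have := words _ w (leqnn _) 0%N; rewrite /f /= => ->; rewrite rmorph0.
Qed.

End Eigen.

(** * Operators commuting with the generators *)

(** Invariance of the range under [A] and [A'] means that it reduces [A]. *)
Lemma commuting_projection (R : realType) (H : hilbert R) (Q A A' : H -> H) :
  adjoint Q Q -> adjoint A A' -> (forall v, Q (A (Q v)) = A (Q v)) ->
  (forall v, Q (A' (Q v)) = A' (Q v)) -> forall v, Q (A v) = A (Q v).
Proof.
move=> hQ hA h h' v; apply: dot_inj => u.
by rewrite -h hQ.2 hA.2 -h' -hQ.2 -hA.2 -hQ.2 h.
Qed.

Section Core.
Variables (R : realType) (n : nat).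
Local Notation C := R[i].
Variables (H K : hilbert R) (E : seq 'I_n -> H) (E1 : seq 'I_n -> K).
Variables (S : 'I_n -> H -> H) (S1 : 'I_n -> K -> K) (s : C).
Hypothesis (n1 : (1 < n)%N) (s0 : 0 < s) (oE : onb E) (oE1 : onb E1).
Hypothesis (hS : semicircular s E S) (hS1 : semicircular 1 E1 S1).
Hypothesis (cond : s ^+ 2 < sqrtC n%:R * `|1 - s ^+ 2|).

Let c := s - s^-1.

(** With [c = - (1 - s ^ 2) / s] this is the hypothesis divided by [s] and
    multiplied by [sqrt n]. *)
Lemma gap_gt0 : 0 < `|c| * n%:R - s * sqrtC n%:R.
Proof.
have s0' : s != 0 by rewrite gt_eqF.
have np : 0 < sqrtC (n%:R : C) by rewrite sqrtC_gt0 ltr0n ltnW.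
have -> : c = - (1 - s ^+ 2) / s by rewrite /c; field.
rewrite normrM normrN normfV (ger0_norm (ltW s0)).
move: cond np; set nu := sqrtC _; have -> : n%:R = nu ^+ 2 by rewrite sqrtCK.
move=> cond' np.
have -> : `|1 - s ^+ 2| / s * nu ^+ 2 - s * nu =
   (nu / s) * (nu * `|1 - s ^+ 2| - s ^+ 2) by field.
by rewrite mulr_gt0 ?divr_gt0 // subr_gt0.
Qed.

(** The words [0 ... 0 1] end with two distinct letters or have length one,
    hence are orthogonal to the range of [M], while a nonzero vector [T x] is
    never orthogonal to [M x]. No combination of these words is thus in the
    range of [T], which makes the complement infinite-dimensional. *)
Lemma intertwiner_splitting : exists T : K -> H, exists Q : H -> H, exists L : H -> K,
  exists2 T' , adjoint T T' & exists2 L', adjoint L L' &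
  [/\ [/\ adjoint Q Q, forall v, T (L v) = Q v, forall x, L (T x) = x &
        forall x, Q (T x) = T x],
      forall i x, S i (T x) = s *: T (S1 i x),
      Q (E [::] + c *: \sum_i E [:: i; i]) = E [::] + c *: \sum_i E [:: i; i] &
      exists e : nat -> H, [/\ forall i j, '[e i, e j] = (i == j)%:R,
        forall k, Q (e k) = 0 &
        forall v, (forall k, '[v, e k] = 0) -> Q v = v]].
Proof.
have [T [M [T' [M' [hT hM] [TE ME TS MM low]]]]] := intertwiner s0 oE1 oE hS1 hS.
rewrite -/c in TE low.
have np : 0 < (n%:R : C) by rewrite ltr0n ltnW.
set d := _ - _ in low; have d0 : 0 < d := gap_gt0.
have low2 x : d ^+ 2 / n%:R * '[x, x] <= '[T x, T x].
  have [->|x0] := eqVneq x 0; first by rewrite dot0l mulr0 dot_ge0.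
  have qx : 0 < '[x, x] by rewrite dot_gt0.
  have h : (d * '[x, x]) ^+ 2 <= '[T x, T x] * (n%:R * '[x, x]).
    rewrite -MM; apply: le_trans (cauchy_schwarz _ _).
    by rewrite ler_pXn2r ?nnegrE ?mulr_ge0 ?dot_ge0 // ltW.
  rewrite mulrAC ler_pdivrMr // -(ler_pM2r qx).
  by apply: le_trans (le_trans _ h) _; rewrite ?exprMn ?expr2 ?mulrA.
have [Q [L [L' hL [hQ TL LT QT]]]] :=
  closed_range (onb_has_onb oE1) (onb_has_onb oE) hT (divr_gt0 (exprn_gt0 2 d0) np) low2.
exists T, Q, L; exists T' => //; exists L' => //; split => //.
  by have := QT (E1 [::]); rewrite TE /= scale1r ME.
pose i0 : 'I_n := Ordinal (ltnW n1); pose i1 : 'I_n := Ordinal n1.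
pose z k := E (rcons (nseq k i0) i1).
have Mz k y : '[z k, M y] = 0.
  rewrite -dotC hM.2 (_ : M' (z k) = 0) ?dot0r ?rmorph0 //.
  apply: oE1.2 => w; rewrite (adjoint_sym hM).2 ME dot_sumr big1 // => i _.
  rewrite oE.1 -cat_rcons cats1 eqseq_rcons.
  case: andP => // -[/eqP h /eqP e].
  have : i \in nseq k i0 by rewrite h mem_rcons mem_head.
  by rewrite mem_nseq -e => /andP[_ /eqP /(congr1 val)].
apply: (@kernel_basis _ _ Q z (onb_has_onb oE)) => //.
- by move=> v; rewrite -[Q v]TL QT.
- move=> i j; rewrite oE.1 eqseq_rcons andbT.
  congr (_ %:R); congr nat_of_bool; apply/eqP/eqP => [|-> //].
  by move=> /(congr1 size); rewrite !size_nseq.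
- move=> N a x Qx; pose xi := L x.
  have xE : x = T xi by rewrite TL.
  have : '[T xi, M xi] = 0.
    by rewrite -xE dot_suml big1 // => i _; rewrite dotZl Mz mulr0.
  have := low xi => /[swap] ->; rewrite normr0 => h.
  suff xi0 : xi = 0 by rewrite -/x xE xi0 (lin0 (adjoint_linear hT)).
  apply/eqP; rewrite -dot_eq0 eq_le dot_ge0 andbT.
  by rewrite -(ler_pM2l d0) mulr0.
Qed.

Definition commuting (y : H -> H) := bounded_op H y /\ forall i v, y (S i v) = S i (y v).

(** The generators are self-adjoint. *)
Lemma commuting_adj y : commuting y -> commuting (adj y).
Proof.
have [hSa _ _] := hS.
move=> [by_ yS]; have hy := adjoint_adj (onb_has_onb oE) by_.
split; first exact: adjoint_bounded_op (adjoint_sym hy).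
move=> i v; apply: dot_inj => u.
by rewrite (adjoint_sym hy).2 (hSa i).2 -yS (hSa i).2 (adjoint_sym hy).2.
Qed.

Section Commutant.
Variables (T : K -> H) (Q : H -> H) (L : H -> K) (hQ : adjoint Q Q).
Hypotheses (TL : forall v, T (L v) = Q v) (QT : forall x, Q (T x) = T x).
Hypothesis (TS : forall i x, S i (T x) = s *: T (S1 i x)).
Hypothesis (QO : Q (E [::] + c *: \sum_i E [:: i; i]) = E [::] + c *: \sum_i E [:: i; i]).

Let lQ := adjoint_linear hQ.
Let p v := v - Q v.

Lemma Q_idem v : Q (Q v) = Q v.
Proof. by rewrite -[Q v]TL QT. Qed.

Lemma Q_generator i v : Q (S i v) = S i (Q v).
Proof.
have [hSa _ _] := hS.
by apply: (commuting_projection hQ (hSa i) _ _ v) => u; rewrite -[Q u]TL TS (linZ lQ) QT.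
Qed.

Lemma p_generator i v : p (S i v) = S i (p v).
Proof. by have [hSa _ _] := hS; rewrite /p Q_generator (linB (adjoint_linear (hSa i))). Qed.

Lemma p_selfadjoint u v : '[p u, v] = '[u, p v].
Proof. by rewrite /p dotBl dotBr hQ.2. Qed.

Lemma p_idem v : p (p v) = p v.
Proof. by rewrite /p (linB lQ) Q_idem subrr subr0. Qed.

Lemma p_linear : linear p.
Proof. exact: dot_adjoint_linear p_selfadjoint. Qed.

(** As [p] kills [E [::] + c sum_i E [:: i; i]], the image under [p] of
    [square_sum (E [::]) = n E [::] + s sum_i E [:: i; i]] is
    [(n - s / c) p (E [::])]. *)
Lemma square_sum_p_vacuum : square_sum S (p (E [::])) =
  (n%:R + s ^+ 2 / (1 - s ^+ 2)) *: p (E [::]).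
Proof.
have [hSa _ _] := hS; have s0' : s != 0 by rewrite gt_eqF.
have t1 := cond_neq0 s0 cond.
have c0 : c != 0.
  apply: contra t1 => /eqP e; have : s * c = 0 by rewrite e mulr0.
  by rewrite /c mulrBr divff // -expr2 => /eqP; rewrite subr_eq0 eq_sym -subr_eq0.
have Np v : square_sum S (p v) = p (square_sum S v).
  rewrite /square_sum (lin_sum _ _ _ p_linear); apply: eq_bigr => i _.
  by rewrite !p_generator.
rewrite Np (square_sum_vacuum hS) p_linear (linZ p_linear).
have : p (E [::] + c *: \sum_i E [:: i; i]) = 0 by rewrite /p QO subrr.
rewrite (linD p_linear) (linZ p_linear) => /eqP; rewrite addr_eq0 => /eqP h.
rewrite scalerDl; congr (_ + _); apply: (scalerI c0).
rewrite [LHS]scalerA mulrC -[LHS]scalerA.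
have -> : c *: p (\sum_i E [:: i; i]) = - p (E [::]) by rewrite h opprK.
rewrite scalerN scalerA -scaleNr.
by congr (_ *: _); rewrite /c; field; rewrite t1.
Qed.

(** The eigenvalue of [p (E [::])] is simple, so [y] multiplies this vector by
    some [g]. For the adjoint [z] of [y - g], the operator [p z] has its range
    orthogonal to the vacuum and commutes with the generators, hence its range
    is orthogonal to all words, which are reached from the vacuum. So [p z = 0],
    and [y - g] vanishes on the range of [p]. *)
Lemma commuting_scalar y : commuting y -> exists g, forall v, y (p v) = g *: p v.
Proof.
move=> cy; have cy' := commuting_adj cy; case: (cy) => by_ yS.
have hy := adjoint_adj (onb_has_onb oE) by_; have ly := adjoint_linear hy.
set eta := p (E [::]).
have [g yg] : exists g, y eta = g *: eta.
  have [e0|e0] := eqVneq eta 0; first by exists 0; rewrite e0 (lin0 ly) scaler0.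
  have etaE : '[eta, E [::]] = '[eta, eta] by rewrite -[RHS]p_selfadjoint /eta p_idem.
  exists ('[y eta, E [::]] / '[eta, E [::]]).
  apply/eqP; rewrite -subr_eq0; apply/eqP.
  apply: (eigen_unique n1 s0 oE hS cond).
    by rewrite -dotC dotBl dotZl divfK ?subrr ?rmorph0 // etaE dot_eq0.
  have lN := adjoint_linear (square_sum_adjoint hS).
  rewrite (linB lN) (linZ lN) square_sum_p_vacuum -/eta.
  have -> : square_sum S (y eta) = y (square_sum S eta).
    by rewrite /square_sum (lin_sum _ _ _ ly); apply: eq_bigr => i _; rewrite !yS.
  rewrite square_sum_p_vacuum -/eta (linZ ly) [RHS]scalerDr scalerN; congr (_ - _).
  by rewrite !scalerA mulrC.
exists g => v; apply/eqP; rewrite -subr_eq0; apply/eqP.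
apply: dot_inj => u; rewrite dot0l.
pose z u := adj y u - Num.conj g *: u.
have zS i w : z (S i w) = S i (z w).
  have [hSa _ _] := hS; have lS := adjoint_linear (hSa i).
  by rewrite /z cy'.2 (linB lS) (linZ lS).
have zE a b : '[z a, b] = '[a, y b - g *: b].
  by rewrite dotBl dotBr dotZl dotZr (adjoint_sym hy).2.
have key w : forall u, '[p (z u), E w] = 0.
  have [m wm] := ubnP (size w); elim: m => // m IH in w wm *.
  have [hSa S0 Sc] := hS.
  case: w wm => [|j w] wm a.
    by rewrite p_selfadjoint -/eta zE yg subrr dot0r.
  have Sjw b : '[p (z b), S j (E w)] = 0.
    by rewrite -(hSa j).2 -p_generator -zS IH //; exact: wm.
  case: w wm Sjw => [|k w] wm Sjw; first by have := Sjw a; rewrite S0.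
  have wm' : (size w < m)%N by exact: ltnW.
  have := Sjw a; rewrite Sc dotDr !dotZr (IH w wm') mulr0 addr0.
  by move/eqP; rewrite mulf_eq0 conjC_eq0 gt_eqF //= => /eqP.
rewrite -[LHS]dotC (_ : '[u, _] = 0) ?rmorph0 //.
rewrite -zE -[u in LHS]/u.
have -> : '[z u, p v] = '[p (z u), v] by rewrite p_selfadjoint.
by rewrite (oE.2 _ (fun w => key w u)) dot0l.
Qed.

(** Both [y] and its adjoint act as scalars on the range of [p], so [p y] and
    [y p] are scalar multiples of [p]; compressing by [p] identifies them. *)
Lemma commuting_split y : commuting y ->
  (exists g, forall v, y (p v) = g *: p v) /\ forall v, y (Q v) = Q (y v).
Proof.
move=> cy; have [g yg] := commuting_scalar cy.
have [g' yg'] := commuting_scalar (commuting_adj cy).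
have hy := adjoint_adj (onb_has_onb oE) cy.1; have ly := adjoint_linear hy.
split; first by exists g.
have py v : p (y v) = Num.conj g' *: p v.
  apply: dot_inj => u; rewrite p_selfadjoint hy.2 yg' dotZr dotZl; congr (_ * _).
  by rewrite p_selfadjoint.
have pyp v : p (y v) = y (p v).
  by rewrite py yg -[X in _ *: X = _]p_idem -py yg (linZ p_linear) p_idem.
by move=> v; have := pyp v; rewrite /p (linB ly) => /addrI /oppr_inj ->.
Qed.

End Commutant.

End Core.

(** * The generated von Neumann algebra *)

Section Algebra.
Variables (R : realType).
Local Notation C := R[i].

Lemma commutantP (H : hilbert R) n (S : 'I_n -> H -> H) y :
  commutant (range S) y <-> commuting S y.
Proof.
split=> -[by_ yS]; split => //.
  by move=> i v; have := yS (S i) (ex_intro2 _ _ i I erefl) => /(congr1 (fun f => f v)).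
by move=> _ [i _ <-]; apply/funext => v /=.
Qed.

Lemma bicommutantP (H : hilbert R) n (S : 'I_n -> H -> H) x :
  bicommutant (range S) x <->
  bounded_op H x /\ forall y, commuting S y -> forall v, x (y v) = y (x v).
Proof.
split=> -[bx xS]; split => //.
  by move=> y /commutantP /xS /(congr1 (fun f => f _)) xy v; have := xy v.
by move=> y /commutantP /xS xy; apply/funext => v /=.
Qed.

End Algebra.

Section CoreTheorems.
Variables (R : realType) (n : nat).
Local Notation C := R[i].
Variables (H K : hilbert R) (E : seq 'I_n -> H) (E1 : seq 'I_n -> K).
Variables (S : 'I_n -> H -> H) (S1 : 'I_n -> K -> K) (s : C).
Hypothesis (n1 : (1 < n)%N) (s0 : 0 < s) (oE : onb E) (oE1 : onb E1).
Hypothesis (hS : semicircular s E S) (hS1 : semicircular 1 E1 S1).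
Hypothesis (cond : s ^+ 2 < sqrtC n%:R * `|1 - s ^+ 2|).

Lemma bicommutant_adj x : bicommutant (range S) x -> bicommutant (range S) (adj x).
Proof.
move=> /bicommutantP[bx xS]; apply/bicommutantP.
have hx := adjoint_adj (onb_has_onb oE) bx.
split; first exact: adjoint_bounded_op (adjoint_sym hx).
move=> y cy v; have cy' := commuting_adj oE hS cy.
have hy := adjoint_adj (onb_has_onb oE) cy.1.
apply: dot_inj => u.
by rewrite (adjoint_sym hx).2 hy.2 -(xS _ cy') [RHS]hy.2 (adjoint_sym hx).2.
Qed.

(** Two orthonormal vectors of the range of [1 - Q] have a nonzero combination
    [psi] orthogonal to the vacuum. The rank one operator on [psi] belongs to the
    algebra, as the operators commuting with the generators are scalar on that
    range. *)
Lemma vacuum_kernel : exists2 x, bicommutant (range S) x &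
  x (E [::]) = 0 /\ x <> cst 0.
Proof.
have [T [Q [L [T' hT [L' hL [[hQ TL LT QT] TS QO [e [oe Qe eQ]]]]]]]] :=
  intertwiner_splitting n1 s0 oE oE1 hS hS1 cond.
have lQ := adjoint_linear hQ.
have [psi [psi0 Qpsi psiO]] : exists psi, [/\ psi != 0, Q psi = 0 & '[E [::], psi] = 0].
  have [h0|h0] := eqVneq '[E [::], e 0%N] 0.
    exists (e 0%N); split => //; rewrite -dot_eq0 oe; exact: oner_neq0.
  exists ('[e 0%N, E [::]] *: e 1%N - '[e 1%N, E [::]] *: e 0%N); split.
  - apply/eqP => /(congr1 (fun v => '[v, e 1%N])).
    rewrite dotBl !dotZl !oe dot0l mulr1 mulr0 subr0 => /eqP.
    by rewrite -dotC conjC_eq0 (negbTE h0).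
  - by rewrite (linB lQ) !(linZ lQ) !Qe !scaler0 subr0.
  - by rewrite dotBr !dotZr !dotC mulrC subrr.
exists (fun v => '[v, psi] *: psi); last first.
  split; first by rewrite psiO scale0r.
  move=> /(congr1 (fun f => f psi)) /= /eqP.
  by rewrite scaler_eq0 dot_eq0 (negbTE psi0).
apply/bicommutantP; split; first exact: adjoint_bounded_op (adjoint_rank1 psi psi).
move=> y cy v.
have [[g yg] yQ] := commuting_split n1 s0 oE hS cond hQ TL QT TS QO cy.
have hy := adjoint_adj (onb_has_onb oE) cy.1; have ly := adjoint_linear hy.
have ppsi : psi - Q psi = psi by rewrite Qpsi subr0.
have p_selfadjoint u : '[u - Q u, psi] = '[u, psi] by rewrite dotBl hQ.2 Qpsi dot0r subr0.
have ypsi : y psi = g *: psi by rewrite -[in LHS]ppsi yg ppsi.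
rewrite (linZ ly) ypsi -(p_selfadjoint (y v)) -yQ -(linB ly) yg dotZl p_selfadjoint scalerA.
by rewrite mulrC.
Qed.

Variables (l2 : hilbert R) (sep : separable l2) (infd : infinite_dimensional l2).

(** The inverse of [x |-> (U^* x U, L x T)] is [(b, d) |-> U b U^* + T d L]. That
    it takes values in the bicommutant rests on [commuting_split], and that the
    second component of the direct map does rests on the transport
    [z |-> T z L] of operators commuting with the [S1 i]. *)
Lemma generated_algebra_iso : star_isomorphic_oplus (bicommutant (range S))
  (bounded_op l2) (bicommutant (range S1)).
Proof.
have [T [Q [L [T' hT [L' hL [[hQ TL LT QT] TS QO [e [oe Qe eQ]]]]]]]] :=
  intertwiner_splitting n1 s0 oE oE1 hS hS1 cond.
have split_ y := commuting_split n1 s0 oE hS cond hQ TL QT TS QO (y := y).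
have obH := onb_has_onb oE; have obK := onb_has_onb oE1.
have obl := separable_has_onb sep.
have [U [U' [hU U'U UU' U'0]]] := isometry_onto sep infd obH oe.
have [[[[lT lL] lQ] lU] lU'] :=
  (adjoint_linear hT, adjoint_linear hL, adjoint_linear hQ, adjoint_linear hU,
   adjoint_linear (adjoint_sym hU)).
have s0' : s != 0 by rewrite gt_eqF.
have [hSa _ _] := hS; have [hS1a _ _] := hS1.
have Q_idem v : Q (Q v) = Q v by rewrite -[Q v]TL QT.
have UU v : U (U' v) = v - Q v.
  have fam : total_family (fun i : nat + H => match i with inl k => e k | inr v => Q v end).
    move=> x hx; have := eQ x (fun k => hx (inl k)) => Qx.
    by have := hx (inr x); rewrite /= Qx => /eqP; rewrite dot_eq0 => /eqP.
  have hP := adjointD (adjoint_id H) (adjointZ (-1) hQ).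
  suff E2 : U \o U' = (fun v => v + (-1) *: Q v).
    by rewrite -[LHS]/((U \o U') v) E2 scaleN1r.
  apply: (eq_on_total fam (adjoint_comp (adjoint_sym hU) hU).2 hP.2) => -[k|w] /=.
    by rewrite UU' Qe scaler0 addr0.
  rewrite U'0 ?(lin0 lU) ?Q_idem ?scaleN1r ?subrr // => k.
  by rewrite hQ.2 Qe dot0r.
have QU v : Q (U v) = 0 by rewrite -[v]U'U UU (linB lQ) Q_idem subrr.
have U'Q v : U' (Q v) = 0.
  by apply: dot_inj => u; rewrite (adjoint_sym hU).2 hQ.2 QU dot0r dot0l.
have U'T v : U' (T v) = 0 by rewrite -QT U'Q.
have LU v : L (U v) = 0.
  by rewrite -[L _]LT TL QU (lin0 lL).
have TinjL v : L (Q v) = L v by rewrite -TL LT.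
have LS i v : L (S i v) = s *: S1 i (L v).
  have Q_generator : Q (S i v) = S i (Q v).
    apply: (commuting_projection hQ (hSa i) _ _ v) => u; by rewrite -[Q u]TL TS (linZ lQ) QT.
  by rewrite -TinjL Q_generator -TL TS (linZ lL) LT.
have T'S i v : T' (S i v) = s *: S1 i (T' v).
  apply: dot_inj => u; rewrite (adjoint_sym hT).2 (hSa i).2 TS dotZr dotZl.
  by rewrite geC0_conj ?(ltW s0) // -(adjoint_sym hT).2 (hS1a i).2.
(* Conjugation by [T] and [L] carries each commutant into the other. *)
have comm1 z z' : adjoint z z' -> commuting S1 z -> commuting S (T \o z \o L).
  move=> hz [_ zS]; split; first exact: adjoint_bounded_op (adjoint_comp hL (adjoint_comp hz hT)).
  by move=> i v /=; rewrite LS TS (linZ (adjoint_linear hz)) zS (linZ lT).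
have comm2 y : commuting S y -> commuting S1 (L \o y \o T).
  move=> [by_ yS]; have hy := adjoint_adj obH by_.
  split; first exact: adjoint_bounded_op (adjoint_comp hT (adjoint_comp hy hL)).
  move=> i v /=; apply: (scalerI s0').
  by rewrite -(linZ lL) -(linZ (adjoint_linear hy)) -TS yS LS.
have commT : commuting S (T \o T').
  split; first exact: adjoint_bounded_op (adjoint_comp (adjoint_sym hT) hT).
  by move=> i v /=; rewrite T'S TS (linZ lT).
have commQ : commuting S Q.
  split; first exact: adjoint_bounded_op hQ.
  by move=> i v; rewrite -TL LS -[Q v]TL TS (linZ lT).
pose pi (x : H -> H) : (l2 -> l2) * (K -> K) := (U' \o x \o U, L \o x \o T).
have pi_adj x : bicommutant (range S) x ->
   adjoint (U' \o x \o U) (U' \o adj x \o U) /\ adjoint (L \o x \o T) (L \o adj x \o T).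
  move=> bx; have := bx => /bicommutantP[bdx xS].
  have hx := adjoint_adj obH bdx.
  split; first exact: (adjoint_comp hU (adjoint_comp hx (adjoint_sym hU))).
  have hLxT := adjoint_comp hT (adjoint_comp hx hL).
  suff <- : (T' \o adj x) \o L' = L \o adj x \o T by [].
  have /bicommutantP[_ xS'] := bicommutant_adj bx.
  (* Inserting [T^* L^* = 1] and moving [T T^*] across the adjoint of [x]. *)
  have L'T' v : T' (L' v) = v.
    by apply: dot_inj => u; rewrite (adjoint_sym hT).2 (adjoint_sym hL).2 LT.
  apply/funext => v /=.
  by rewrite -[LHS]LT -[T (T' _)]/((T \o T') _) -(xS' _ commT) /= L'T'.
exists pi; split.
- split.
  + move=> x bx; have [h1 h2] := pi_adj x bx.
    have := bx => /bicommutantP[bdx xS].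
    split; first exact: adjoint_bounded_op h1.
    apply/bicommutantP; split; first exact: adjoint_bounded_op h2.
    move=> z cz v /=; have hz := adjoint_adj obK cz.1.
    have := xS _ (comm1 _ _ hz cz) (T v) => /= e1.
    by rewrite LT in e1; rewrite e1 LT.
  + move=> x y; rewrite !inE => bx by_ [e1 e2].
    have rec x' : bicommutant (range S) x' -> forall v,
        x' v = U (U' (x' (U (U' v)))) + T (L (x' (T (L v)))).
      move=> /bicommutantP[bdx xS] v; have lx := bdx.1.
      have xQ w : x' (Q w) = Q (x' w) by exact: (xS _ commQ).
      rewrite !UU !TL (linB lx) (linB lQ) !xQ Q_idem.
      by rewrite subrr subr0 subrK.
    apply/funext => v; rewrite (rec x bx) (rec y by_).
    congr (_ + _).
      by have := congr1 (fun f => f (U' v)) e1 => /= ->.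
    by have := congr1 (fun f => f (L v)) e2 => /= ->.
  + move=> [b d] /= [bb bd].
    have := bd => /bicommutantP[bdd dS].
    have hb := adjoint_adj obl bb; have hd := adjoint_adj obK bdd.
    pose x v := U (b (U' v)) + T (d (L v)).
    have hx := adjointD (adjoint_comp (adjoint_comp (adjoint_sym hU) hb) hU)
                       (adjoint_comp (adjoint_comp hL hd) hT).
    exists x.
      apply/bicommutantP; split; first exact: adjoint_bounded_op hx.
      move=> y cy v; have [[g yg] yQ] := split_ y cy.
      have hy := adjoint_adj obH cy.1; have ly := adjoint_linear hy.
      have yU u : y (U u) = g *: U u by rewrite -[u]U'U UU yg.
      have U'y u : U' (y u) = g *: U' u.
        rewrite -[y u](subrK (Q (y u))) (linD lU') U'Q addr0 -yQ -(linB ly) yg.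
        by rewrite (linZ lU') (linB lU') U'Q subr0.
      have lb := adjoint_linear hb; have ld := adjoint_linear hd.
      rewrite /x U'y (linZ lb) (linZ lU) (linD ly) yU; congr (_ + _).
      rewrite -TinjL -yQ -TL -[L (y _)]/((L \o y \o T) (L v)) (dS _ (comm2 _ cy)) /=.
      by rewrite TL -yQ QT.
    congr (_, _); apply/funext => v; rewrite /= /x.
      by rewrite (linD lU') U'U U'U U'T addr0.
    by rewrite (linD lL) LT LU add0r LT.
- move=> a x y bx by_; rewrite /pi /=.
  by congr (_, _); apply/funext => v /=; rewrite ?(linD lU') ?(linZ lU') ?(linD lL) ?(linZ lL).
- move=> x y bx by_; rewrite /pi /=.
  have /bicommutantP[bdx xS] := bx; have /bicommutantP[bdy yS] := by_.
  have lx := bdx.1.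
  congr (_, _); apply/funext => v /=.
    by rewrite UU (linB lx) (linB lU') (xS _ commQ) U'Q subr0.
  by rewrite TL (xS _ commQ) TinjL.
- move=> x bx; have [h1 h2] := pi_adj x bx.
  by rewrite /pi /= (adjE h1) (adjE h2).
Qed.

End CoreTheorems.

(** * The Fock space in the basis of words *)

(** The creation operators map distinct words to orthogonal vectors of bounded
    norm. *)
Lemma creation_family (R : realType) n (H : hilbert R) (E : seq 'I_n -> H) (s : R[i]) :
  0 < s -> onb E -> exists l : 'I_n -> H -> H, exists2 l' : 'I_n -> H -> H,
    forall i, adjoint (l i) (l' i) &
    (forall i w, l i (E w) = kappa s w *: E (i :: w)) /\
    semicircular s E (fun i v => l i v + l' i v).
Proof.
move=> s0 oE.
have ex i : exists l : H -> H, exists2 l', adjoint l l' &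
    forall w, l (E w) = kappa s w *: E (i :: w).
  have B0 : 0 <= 1 + s ^+ 2 by rewrite addr_ge0 // exprn_ge0 // ltW.
  apply: (ortho_extension (B := 1 + s ^+ 2) oE B0).
    move=> u v /negbTE uv; rewrite dotZl dotZr oE.1 eqseq_cons eqxx uv.
    by rewrite !mulr0.
  move=> w; rewrite dotZZ oE.1 eqxx mulr1; case: w => [|j w] /=.
    by rewrite normr1 expr1n lerDl exprn_ge0 // ltW.
  by rewrite (ger0_norm (ltW s0)) lerDr.
have /choice[l hl] := ex.
have /choice[l' hl'] : forall i, exists l', adjoint (l i) l'.
  by move=> i; have [l' h _] := hl i; exists l'.
have lE i w : l i (E w) = kappa s w *: E (i :: w) by have [? _] := hl i.
have kR w : Num.conj (kappa s w) = kappa s w.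
  by case: w => [|j w] /=; rewrite ?rmorph1 // geC0_conj // ltW.
have l'0 i : l' i (E [::]) = 0.
  by apply: oE.2 => w; rewrite (adjoint_sym (hl' i)).2 lE dotZr oE.1 mulr0.
have l'E i j w : l' i (E (j :: w)) = ((i == j)%:R * kappa s w) *: E w.
  apply/eqP; rewrite -subr_eq0; apply/eqP; apply: oE.2 => u.
  rewrite dotBl (adjoint_sym (hl' i)).2 lE dotZr dotZl !oE.1 eqseq_cons kR.
  rewrite [j == i]eq_sym; case: eqVneq => _ /=; last by rewrite mulr0 !mul0r subrr.
  by rewrite mul1r; case: eqVneq => [->|]; rewrite ?subrr // !mulr0 subrr.
exists l, l' => //; split => //; split.
- move=> i; have h := adjointD (hl' i) (adjoint_sym (hl' i)).
  by rewrite [X in adjoint _ X](_ : _ = fun v => l' i v + l i v) //; apply/funext => v; rewrite addrC.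
- by move=> i; rewrite lE l'0 scale1r addr0.
- by move=> i j w; rewrite lE l'E.
Qed.

(** Gram-Schmidt on a basis spans the space by [\dim V] vectors, which are
    therefore free and nonzero. *)
Lemma real_orthonormal_basis (R : realType) (V : vectType R) (dot : {dot V for idfun}) :
  exists e : 'I_(\dim {:V}) -> V, (forall i j, dot (e i) (e j) = (i == j)%:R) /\
    forall v, v = \sum_i dot v (e i) *: e i.
Proof.
have dotS u v : dot u v = dot v u by rewrite hermC /= expr0 mul1r.
have dot0 u : dot u u = 0 -> u = 0.
  move=> h; apply/eqP; apply: contraT => /(neq0_dnorm_gt0 (s := dot)).
  by rewrite h ltxx.
have [||y [yo yx]] := @gram_schmidt _ V dot _ _ dot0 (fun k => (vbasis {:V})`_k).
- by move=> c u v w; rewrite linearPl.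
- by move=> u v; rewrite dotS.
set n := \dim {:V}.
pose Y := [tuple y i | i < n].
have bY : basis_of {:V} Y.
  rewrite basisEdim size_tuple leqnn andbT -{1}(span_basis (vbasisP {:V})).
  have yY (i : nat) : (i < n)%N -> y i \in <<Y>>%VS.
    move=> lin; apply: memv_span; apply/tnthP; exists (Ordinal lin).
    by rewrite tnth_mktuple.
  apply/span_subvP => x /(nthP 0)[k]; rewrite size_tuple => kn <-.
  have [c ->] := yx k; rewrite rpredD ?yY // rpred_sum // => i _.
  by rewrite rpredZ // yY // (ltn_trans (ltn_ord i)).
have y0 (i : 'I_n) : y i != 0.
  have := free_not0 (v := y i) (basis_free bY); apply.
  by apply/tnthP; exists i; rewrite tnth_mktuple.
have yy (i : 'I_n) : 0 < dot (y i) (y i) by apply: neq0_dnorm_gt0.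
have dZl c u v : dot (c *: u) v = c * dot u v by rewrite linearZl_LR.
have dZr c u v : dot u (c *: v) = c * dot u v by rewrite dotS dZl dotS.
pose e (i : 'I_n) := (Num.sqrt (dot (y i) (y i)))^-1 *: y i.
have oe i j : dot (e i) (e j) = (i == j)%:R.
  rewrite dZl dZr; have [<-|ij] := eqVneq i j; last by rewrite (yo _ _ ij) !mulr0.
  rewrite mulrA -invfM -expr2 sqr_sqrtr ?(ltW (yy i)) // mulVf //.
  by rewrite gt_eqF.
exists e; split => // v.
have [a va] : exists a : 'I_n -> R, v = \sum_i a i *: e i.
  exists (fun i => coord Y i v * Num.sqrt (dot (y i) (y i))).
  rewrite {1}(coord_basis bY (memvf v)); apply: eq_bigr => i _.
  rewrite scalerA mulfK; last by rewrite sqrtr_eq0 -ltNge.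
  by congr (_ *: _); rewrite -(tnth_nth 0 Y i) tnth_mktuple.
rewrite {1}va; apply: eq_bigr => i _; congr (_ *: _).
rewrite va linear_sumlz (bigD1 i) //= dZl oe eqxx mulr1 big1 ?addr0 // => j ji.
by rewrite dZl oe (negbTE ji) mulr0.
Qed.

Section FockInterface.
Variables (R : realType) (V : vectType R) (dot : {dot V for idfun}) (n : nat).
Local Notation C := R[i].
Variables (e : 'I_n -> V).
Hypothesis (n0 : (0 < n)%N).
Hypothesis (oe : forall i j, dot (e i) (e j) = (i == j)%:R).
Hypothesis (ee : forall v, v = \sum_i dot v (e i) *: e i).

Lemma complexification_expand (h : complexification V) :
  h = \sum_i (dot h.1 (e i) +i* dot h.2 (e i)) *: complexify (e i).
Proof.
case: h => a b /=; apply: injective_projections => /=.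
  rewrite (big_morph (fun x : complexification V => x.1) (id1 := 0) (op1 := +%R)) //=.
  by rewrite [LHS]ee; apply: eq_bigr => i _; rewrite scaler0 subr0.
rewrite (big_morph (fun x : complexification V => x.2) (id1 := 0) (op1 := +%R)) //=.
by rewrite [LHS]ee; apply: eq_bigr => i _; rewrite scaler0 add0r.
Qed.

Lemma complexify_expand (v : V) :
  complexify v = \sum_i (dot v (e i))%:C *: complexify (e i).
Proof.
rewrite {1}[complexify v]complexification_expand; apply: eq_bigr => i _ /=.
by rewrite linear0l.
Qed.

(** The slots are expanded one at a time from the left, the induction carrying
    the word in the basis letters already obtained. The zero vector of a slot is
    reached as [h - h], which takes at least one basis vector. *)
Lemma multilinear_ind (P : seq (complexification V) -> Prop) :
  (forall s1 s2 (c : C) h h', P (s1 ++ h :: s2) -> P (s1 ++ h' :: s2) ->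
     P (s1 ++ (c *: h + h') :: s2)) ->
  (forall w : seq 'I_n, P (map (fun i => complexify (e i)) w)) ->
  forall s, P s.
Proof.
move=> Plin Pw s; rewrite -[s]cat0s -[[::] in X in P X]/(map (fun i => complexify (e i)) [::]).
elim: s [::] => [|h s IH] w; first by rewrite cats0; apply: Pw.
rewrite [h]complexification_expand.
have Pe i : P (map (fun i => complexify (e i)) w ++ complexify (e i) :: s).
  by have := IH (rcons w i); rewrite map_rcons cat_rcons.
elim/big_rec: _ => [|i x _ Px]; last exact: Plin.
have := Plin _ _ (-1) _ _ (Pe (Ordinal n0)) (Pe (Ordinal n0)).
by rewrite scaleN1r addNr.
Qed.

Variables (t : R) (t0 : 0 < t) (F : fock dot t).
Let s : C := (Num.sqrt t)%:C.

Definition basis_tensor (w : seq 'I_n) : F :=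
  tens F (map (fun i => complexify (e i)) w).

(** The tensor [e_w] has squared norm [t ^ (k - 1)] in degree [k >= 1] and [1] in
    degree [0], in accordance with [0.-1 = 0]. *)
Definition word_basis (w : seq 'I_n) : F :=
  (s ^+ (size w).-1)^-1 *: basis_tensor w.

Lemma sqrt_gt0 : 0 < s.
Proof. by rewrite /s -[0]/(0%:C) ltcR sqrtr_gt0. Qed.

Lemma sqrt_sqr : s ^+ 2 = t%:C.
Proof. by rewrite /s -rmorphXn /= sqr_sqrtr // ltW. Qed.

Lemma basis_tensor_dot u v :
  '[basis_tensor u, basis_tensor v] = (u == v)%:R * t%:C ^+ (size u).-1.
Proof.
rewrite /basis_tensor tens_dot !size_map.
have dotE i j : complexification_dot dot (complexify (e i)) (complexify (e j)) = (i == j)%:R.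
  by rewrite /complexification_dot /= oe !linear0l linear0r addr0 subrr; case: (i == j).
have [suv|suv] := eqVneq (size u) (size v); last first.
  by case: eqVneq => [uv|]; rewrite ?mul0r //; rewrite uv eqxx in suv.
rewrite mulrC; congr (_ * _).
elim: u v suv => [|i u IH] [|j v] //= suv; first by rewrite big_nil.
rewrite big_cons dotE IH; last by case: suv.
by rewrite eqseq_cons; case: (i == j); rewrite ?mul0r ?mul1r.
Qed.

Lemma word_onb : onb word_basis.
Proof.
have s0 := sqrt_gt0.
have sn0 k : s ^+ k != 0 by rewrite expf_neq0 // gt_eqF.
split=> [u v|v hv].
  rewrite dotZl dotZr basis_tensor_dot.
  case: eqVneq => [<-|_]; last by rewrite mul0r !mulr0.
  rewrite mul1r -sqrt_sqr geC0_conj ?invr_ge0 ?exprn_ge0 ?(ltW s0) //.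
  have -> k : (s ^+ 2) ^+ k = s ^+ k * s ^+ k by rewrite -exprM mulnC exprM expr2.
  by rewrite mulrA -invfM mulVf // mulf_neq0.
apply: (dense_total (tens_total (f := F))) => _ [w _ <-].
rewrite dot_sumr big1 // => p _; rewrite dotZr.
suff -> : '[v, tens F p.2] = 0 by rewrite mulr0.
move: p.2; apply: multilinear_ind.
  move=> s1 s2 c h h' h0 h0'; have /= lin := tens_multilinear F s1 s2.
  by rewrite lin dotDr dotZr h0 h0' mulr0 addr0.
move=> u; have := hv u; rewrite dotZr => /eqP.
rewrite mulf_eq0 conjC_eq0 invr_eq0 (negbTE (sn0 _)) /= => /eqP //.
Qed.

Lemma word_basis0 : word_basis [::] = vacuum F.
Proof. by rewrite /word_basis expr0 invr1 scale1r. Qed.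

(** The operator that creates the real coordinates of [v] letter by letter has
    the defining property of [creation F v] on all tensors by multilinearity, and
    tensors are total. *)
Lemma gaussian_expand : exists2 S : 'I_n -> F -> F, semicircular s word_basis S &
  forall v x, gaussian F v x = \sum_i (dot v (e i))%:C *: S i x.
Proof.
have s0 := sqrt_gt0; have oE := word_onb.
have [l [l' hl [lE lS]]] := creation_family s0 oE.
exists (fun i v => l i v + l' i v) => // v.
have lt i u : l i (tens F u) = tens F (complexify (e i) :: u).
  move: u; apply: multilinear_ind => [s1 s2 c h h' h0 h0'|w].
    have lin := tens_multilinear F s1 s2.
    have lin' := tens_multilinear F (complexify (e i) :: s1) s2.
    by rewrite /= in lin lin'; rewrite lin (adjoint_linear (hl i)) h0 h0' lin'.
  have := lE i w; rewrite /word_basis (linZ (adjoint_linear (hl i))) => /(congr1 ( *:%R (s ^+ (size w).-1))).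
  rewrite !scalerA /basis_tensor /= divff ?scale1r ?expf_neq0 ?gt_eqF // => ->.
  case: w => [|j w] /=; first by rewrite mulr1 divr1 scale1r.
  by rewrite -exprSr divff ?scale1r // expf_neq0 // gt_eqF.
pose A x := \sum_i (dot v (e i))%:C *: l i x.
pose A' x := \sum_i Num.conj (dot v (e i))%:C *: l' i x.
have hA : adjoint A A' by apply: adjoint_sum => i; apply: adjointZ.
have AE : creation F v = A.
  set P := [set l0 | bounded_op F l0 /\ forall u, l0 (tens F u) = tens F (complexify v :: u)]%classic.
  have PA : P A.
    split; first exact: adjoint_bounded_op hA.
    move=> u; rewrite complexify_expand /A.
    have /= lin := tens_multilinear F [::] u.
    have t00 : tens F (0 :: u) = 0.
      by have := lin (-1) 0 0; rewrite scaler0 addr0 scaleN1r addNr.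
    rewrite (big_morph (fun h => tens F (h :: u)) (id1 := 0) (op1 := +%R)) //.
      apply: eq_bigr => i _; rewrite lt.
      by have := lin (dot v (e i))%:C (complexify (e i)) 0; rewrite t00 !addr0.
    by move=> x y; have := lin 1 x y; rewrite !scale1r.
  have [b1 c1] : P (creation F v) by apply: (@xgetPex _ _ P); exists A.
  have hc := adjoint_adj (onb_has_onb oE) b1.
  apply: (eq_on_total oE.2 hc.2 hA.2) => w.
  rewrite (linZ (adjoint_linear hc)) (linZ (adjoint_linear hA)) c1; congr (_ *: _).
  by case: PA => _ ->.
move=> x; rewrite /gaussian AE (adjE hA) /A /A' -big_split; apply: eq_bigr => i _.
have -> : Num.conj (dot v (e i))%:C = (dot v (e i))%:C :> C by exact: conjc_real.
by rewrite scalerDr.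
Qed.

Lemma gaussian_algebraE : exists2 S : 'I_n -> F -> F, semicircular s word_basis S &
  gaussian_algebra F = bicommutant (range S).
Proof.
have [S hS gE] := gaussian_expand; exists S => //.
have [hSa _ _] := hS.
rewrite /gaussian_algebra /bicommutant; congr commutant.
apply/seteqP; split => y [by_ yS]; split => //.
  move=> _ [i _ <-]; have -> : S i = gaussian F (e i).
    apply/funext => x; rewrite gE (bigD1 i) //= oe eqxx scale1r big1 ?addr0 // => j ji.
    by rewrite oe eq_sym (negbTE ji) scale0r.
  by apply: yS; exists (e i).
move=> _ [v _ <-]; apply/funext => x /=; rewrite !gE.
have ly := by_.1; rewrite (lin_sum _ _ _ ly); apply: eq_bigr => i _.
rewrite (linZ ly); congr (_ *: _).
by have := yS (S i) (ex_intro2 _ _ i I erefl) => /(congr1 (fun f => f x)).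
Qed.

End FockInterface.

(** With [r = sqrt n], the end points of the interval are [r / (r + 1)] and
    [r / (r - 1)], so that [t] lies outside exactly when [t < r |1 - t|]. *)
Lemma gap_condition (R : realType) (n : nat) (t : R) : (2 <= n)%N -> 0 < t ->
  t \notin `[n%:R / (n%:R + Num.sqrt n%:R), n%:R / (n%:R - Num.sqrt n%:R)] ->
  (Num.sqrt t)%:C ^+ 2 < sqrtC n%:R * `|1 - (Num.sqrt t)%:C ^+ 2| :> R[i].
Proof.
move=> n2 t0 ht.
set r := Num.sqrt n%:R in ht.
have rr : r ^+ 2 = n%:R by rewrite sqr_sqrtr // ler0n.
have r1 : 1 < r by rewrite -[1]sqrtr1 ltr_sqrt ?ltr0n ?(ltn_trans _ n2) // ltr1n.
have -> : sqrtC (n%:R : R[i]) = r%:C.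
  rewrite -(rmorph_nat (real_complex R)) -rr rmorphXn /= sqrCK //.
  by rewrite -[0]/(0%:C) lecR ltW // (lt_trans ltr01).
rewrite sqrt_sqr // -[1]/(1%:C) -rmorphB /=.
have -> : `|(1 - t)%:C| = `|1 - t|%:C :> R[i] by rewrite normc_def /= expr0n addr0 sqrtr_sqr.
rewrite -rmorphM ltcR.
have p1 : 0 < n%:R + r by rewrite -rr; nra.
have p2 : 0 < n%:R - r by rewrite -rr; nra.
move: ht; rewrite in_itv /= negb_and -!ltNge => /orP[].
  rewrite ltr_pdivlMr // -rr => h.
  by apply: (@lt_le_trans _ _ (r * (1 - t))); [nra|rewrite ler_pM2l ?ler_norm //; lra].
rewrite ltr_pdivrMr // -rr => h.
apply: (@lt_le_trans _ _ (r * (t - 1))); first by nra.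
by rewrite distrC ler_pM2l ?ler_norm //; lra.
Qed.

Theorem theorem3p14 (R : realType) (n : nat) (hn : (2 <= n)%N)
    (t : R) (t_gt0 : 0 < t)
    (ht : t \notin `[n%:R / (n%:R + Num.sqrt n%:R),
                     n%:R / (n%:R - Num.sqrt n%:R)])
    (V : vectType R) (dot : {dot V for idfun}) (dimV : \dim {:V} = n)
    (F : fock dot t) :
  (forall (F1 : fock dot 1) (l2 : hilbert R),
      separable l2 -> infinite_dimensional l2 ->
      star_isomorphic_oplus (gaussian_algebra F) (bounded_op l2)
        (gaussian_algebra F1)) /\
  ~ faithful_on (gaussian_algebra F) (vacuum_state F).
Proof.
have cond := gap_condition hn t_gt0 ht.
have [e [oe ee]] := real_orthonormal_basis dot; rewrite dimV in e oe ee.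
have n0 : (0 < n)%N := ltnW hn.
have oE := word_onb n0 oe ee t_gt0 F.
have [S hS ->] := gaussian_algebraE n0 oe ee t_gt0 F.
have s0 := sqrt_gt0 t_gt0.
split.
  move=> F1 l2 sep infd.
  have oE1 := word_onb n0 oe ee ltr01 F1.
  have [S1 hS1 ->] := gaussian_algebraE n0 oe ee ltr01 F1.
  rewrite sqrtr1 in hS1.
  exact: (generated_algebra_iso hn s0 oE oE1 hS hS1 cond sep infd).
have [l [l' _ [_ hS1]]] := creation_family ltr01 oE.
have [x xS [xO xn0]] := vacuum_kernel hn s0 oE oE hS hS1 cond.
move=> /(_ x xS) faith; apply: xn0; apply: faith.
have hx := adjoint_adj (onb_has_onb oE) xS.1.
rewrite /vacuum_state /= -(word_basis0 e F) xO.
by rewrite (lin0 (adjoint_linear (adjoint_sym hx))) dot0l.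
Qed.
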